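(* Let $p<q<r$ be odd primes such that $q\equiv r \pmod p$ or $q\equiv -r\pmod p$. If $b$ is a positive integer with $b\leq 5$, then $\mathrm{B}(pq^b)=\mathrm{B}(pr^b)$.
   Context: The height $\mathrm{H}(f)$ of a polynomial $f\in\mathbb{Z}[x]$ is the largest absolute value of its coefficients. For a positive integer $n$, $\mathrm{B}(n):=\max\{\mathrm{H}(f) : f\in\mathbb{Z}[x],\ f \mid x^{n}-1\}$. *)

(* Defs.v *)
From mathcomp Require Import all_boot all_order all_algebra all_field.
From mathcomp Require Import boolp classical_sets.

Set Implicit Arguments.
Unset Strict Implicit.
Unset Printing Implicit Defensive.

Import Order.TTheory GRing.Theory Num.Theory.

Local Open Scope ring_scope.

Definition height (f : {poly int}) : nat := (\max_(i < size f) `|(f`_i)%R|)%N.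

(* Divisibility in Z[x] itself: the %| of polydiv.v is pseudo-divisibility over
   int, i.e. divisibility in Q[x], for which every nonzero constant divides
   every polynomial. *)
Definition dvdpZ (f g : {poly int}) : Prop := exists h : {poly int}, g = h * f.

Definition is_max_height (n m : nat) : Prop :=
  (exists2 f : {poly int}, dvdpZ f ('X^n - 1) & height f = m) /\
  (forall f : {poly int}, dvdpZ f ('X^n - 1) -> (height f <= m)%N).

(* The default value 0 is only reached for n = 0, see B_is_max_height. *)
Definition B (n : nat) : nat := xget 0%N (is_max_height n).

Lemma coef_prod_XsubC_bound (s : seq algC) (i : nat) :
  {in s, forall x, `|x| <= 1} ->
  `|(\prod_(x <- s) ('X - x%:P))`_i| <= (2 ^ size s)%:R :> algC.
Proof.
elim: s i => [|x s IHs] i s1.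
  by rewrite big_nil coef1; case: (i == _); rewrite ?normr1 ?normr0.
have {}IHs j : `|(\prod_(x <- s) ('X - x%:P))`_j| <= (2 ^ size s)%:R :> algC.
  by apply: IHs => y ys; apply: s1; rewrite inE ys orbT.
rewrite big_cons mulrBl coefB coefXM coefCM /= expnS mul2n -addnn natrD.
apply: le_trans (ler_normB _ _) _; apply: lerD.
  by case: (i == 0)%N; rewrite ?normr0 ?ler0n.
rewrite normrM -[leRHS]mul1r; apply: ler_pM => //.
by apply: s1; rewrite mem_head.
Qed.

Lemma height_dvdpZ_bound (n : nat) (f : {poly int}) :
  (0 < n)%N -> dvdpZ f ('X^n - 1) -> (height f <= 2 ^ n)%N.
Proof.
move=> n_gt0 [h hf].
have lcf : `|lead_coef f|%N = 1%N.
  have /(congr1 absz) : lead_coef h * lead_coef f = 1.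
    by rewrite -lead_coefM -hf; apply/monicP; rewrite monicXnsubC.
  by rewrite abszM => /eqP; rewrite muln_eq1 => /andP[_ /eqP].
have [z zP] := C_prim_root_exists n_gt0.
pose toC : {poly int} -> {poly algC} := map_poly intr.
have hfC : \prod_(0 <= i < n) ('X - (z ^+ i)%:P) = toC h * toC f.
  rewrite (factor_Xn_sub_1 zP) -rmorphM -hf /toC rmorphB /= map_polyXn.
  by rewrite rmorph1.
have /dvdp_prod_XsubC[m] : toC f %| \prod_(i <- index_iota 0 n) ('X - (z ^+ i)%:P).
  by rewrite hfC dvdp_mull.
rewrite -(big_map (fun i => z ^+ i) predT (fun x => 'X - x%:P)).
set s := map _ _ => /eqpfP fE.
have s1 : {in s, forall x, `|x| <= 1}.
  move=> _ /mapP[i _ ->]; rewrite normrX.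
  have /eqP : `|z| ^+ n == 1 by rewrite -normrX prim_expr_order ?normr1.
  by move/eqP; rewrite pexpr_eq1 // => /eqP ->; rewrite expr1n.
apply/bigmax_leqP => i _.
have : `|(toC f)`_i| <= (2 ^ n)%:R :> algC.
  rewrite fE coefZ (monicP (monic_prod_XsubC _ _ _)) divr1 normrM.
  rewrite lead_coef_map_inj //; last exact: intr_inj.
  rewrite -intr_norm -abszE lcf mul1r.
  apply: le_trans (coef_prod_XsubC_bound _ s1) _.
  rewrite ler_nat leq_exp2l // size_map.
  by rewrite (leq_trans (size_subseq (mask_subseq _ _))) // size_iota subn0.
by rewrite coef_map /= -intr_norm -abszE ler_nat.
Qed.

Lemma B_is_max_height (n : nat) : (0 < n)%N -> is_max_height n (B n).
Proof.
move=> n_gt0; apply: xgetPex.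
pose P m := `[< exists2 f : {poly int}, dvdpZ f ('X^n - 1) & height f = m >].
have exP : exists m, P m.
  exists (height 1); apply/asboolP; exists 1 => //.
  by exists ('X^n - 1); rewrite mulr1.
have ubP m : P m -> (m <= 2 ^ n)%N.
  by move=> /asboolP[f fn <-]; exact: height_dvdpZ_bound.
case: (ex_maxnP exP ubP) => m /asboolP Pm mP; exists m; split=> // f fn.
by apply: mP; apply/asboolP; exists f.
Qed.

(* Main.v *)
Require Import Defs.
From mathcomp Require Import all_boot all_order all_algebra.
From mathcomp Require Import all_field.
From mathcomp Require Import zify ring.
From mathcomp Require boolp.

Set Implicit Arguments.
Unset Strict Implicit.
Unset Printing Implicit Defensive.

Import Order.TTheory GRing.Theory Num.Theory.

Local Open Scope ring_scope.

(* Up to sign, a divisor of [X^(p q^b) - 1] is a product of the [Phi_(q^i)] and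
   [Phi_(p q^i)] with exponents [e_i], [f_i] in {0, 1}: a word in the pairs
   [(e_i, f_i)].  Substituting [X^q] for [X] turns [1 - X] and [Phi_p] into
   [(1 - X) Phi_q] and [Phi_p Phi_(p q)], so the coefficient of index [m + q n],
   [m < q], of such a product is computed by a state machine on sequences: each
   letter of the word multiplies by [1 - X], [Phi_p] or their inverses and then
   samples the result on the residue class of [m] modulo [q].

   As long as no periodic state is multiplied by [1 - X] alone, every state is
   either constant after its first terms, and then the samples do not depend on
   [q > p], or [p]-periodic, and then they depend only on [q] modulo [p];
   replacing [q] by [- q] reverses a period, which palindromicity absorbs.  Hence
   these words give the same absolute values of coefficients for [q] and [r].

   Let [s] be the inverse of [q] modulo [p], and [mu = max(s, p - s)], which is
   the same for [q] and [r].  For [b <= 5], tracking norms of the states shows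
   that every other word has height at most [p * mu ^ ((b - 1) / 2)], and this
   height is attained by the word alternating (0, 1) and (1, 0), so that such
   words cannot break the equality. *)

(** * Divisors of [X^(p q^b) - 1] as words *)

(** Origin of [p] and [mu]: a window of [p] terms over a constant gives the factor [p]. The constant
    state [c / (1 - X)] times [(1 - X) / Phi_p = (1 - X)^2 / (1 - X^p)] becomes pulses [c], [- c] at
    the residues 0 and 1 modulo [p]. Sampled in steps of [q] they lie [s] apart cyclically, so their
    partial sums equal [c] or [- c] on a stretch of length [s] or [p - s], and summing over a period
    gives at best [mu * c]. Obstacle: a periodic state times [1 - X] lacks the term of index -1, so
    it is periodic only from index 1 on, while the reversal used for [q = - r] needs a pure period.
    Such words are therefore bounded, not compared. The bound must be a height that is attained, so
    no constant may be lost; hence the many norms carried along (values and oscillation, sums of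
    absolute values, the same for partial sums, masses of the two signs). For [b <= 5] there are at
    most [4^6] words. They are checked by computation on monomials in [p] and [mu], compared through
    [2 <= mu < p <= mu^2] only. *)

Lemma Cyclotomic_neq0 n : 'Phi_n != 0 :> {poly int}.
Proof. exact/monic_neq0/Cyclotomic_monic. Qed.

Lemma Xnsub1_neq0 n : (0 < n)%N -> 'X^n - 1 != 0 :> {poly int}.
Proof. by move=> n0; apply/monic_neq0/monicXnsubC. Qed.

Definition ZtoC : {rmorphism {poly int} -> {poly algC}} := map_poly intr.

(** The minimal polynomial of [z] over the rationals is ['Phi_d]. As ['Phi_d] is monic, division
    with remainder stays over the integers, and the remainder, divisible by ['Phi_d] but of smaller
    degree, is 0. *)
Lemma Cyclotomic_root_dvdpZ d (z : algC) (f : {poly int}) :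
  d.-primitive_root z -> root (ZtoC f) z -> dvdpZ 'Phi_d f.
Proof.
move=> zP fz0.
have [pq [pqE _] pq_dvd] := minCpolyP z.
have phiE : map_poly ratr pq = ZtoC 'Phi_d.
  by rewrite -pqE (minCpoly_cyclotomic zP) -(Cintr_Cyclotomic zP).
have ZQC (g : {poly int}) : map_poly ratr (map_poly intr g : {poly rat}) = ZtoC g.
  by rewrite -map_poly_comp; apply: eq_map_poly => x /=; rewrite ratr_int.
have Qphi : pq = map_poly intr 'Phi_d.
  by apply: (map_poly_inj (ratr : {rmorphism rat -> algC})); rewrite ZQC.
have : pq %| map_poly intr f by rewrite -pq_dvd ZQC.
have mP := Cyclotomic_monic d.
rewrite (Pdiv.IdomainMonic.divp_eq mP f) rmorphD rmorphM /= -Qphi dvdp_addr ?dvdp_mull //.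
rewrite {1}Qphi => /dvdp_leq; rewrite !size_map_inj_poly //; try exact: intr_inj.
have [r0 _|rN0] := eqVneq (f %% 'Phi_d) 0.
  by exists (f %/ 'Phi_d); rewrite r0 addr0.
rewrite map_poly_eq0_id0 ?intr_eq0 ?lead_coef_eq0 // => /(_ rN0).
by rewrite leqNgt ltn_modp Cyclotomic_neq0.
Qed.

Lemma Cyclotomic_prime d (f h : {poly int}) : (0 < d)%N ->
  dvdpZ 'Phi_d (f * h) -> dvdpZ 'Phi_d f \/ dvdpZ 'Phi_d h.
Proof.
move=> d_gt0 [g fhE]; have [z zP] := C_prim_root_exists d_gt0.
have : root (ZtoC (f * h)) z.
  rewrite fhE rmorphM rootM; apply/orP; right.
  by rewrite [ZtoC _](Cintr_Cyclotomic zP) root_cyclotomic.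
rewrite rmorphM rootM => /orP[] /(Cyclotomic_root_dvdpZ zP); by [left | right].
Qed.

(** Each ['Phi_d] is prime over the integers, so it can be charged to [f] or to [h]; the mask
    records those charged to [f], and only the units 1 and -1 remain. *)
Lemma dvdpZ_prod_Cyclotomic (s : seq nat) (f h : {poly int}) :
  (forall d, d \in s -> 0 < d)%N -> f * h = \prod_(d <- s) 'Phi_d ->
  exists (u : bool) (m : bitseq), size m = size s /\
    f = (-1) ^+ u * \prod_(d <- mask m s) 'Phi_d.
Proof.
elim: s f h => [|d s IHs] f h s_gt0.
  rewrite big_nil => fh1.
  have : f \is a GRing.unit by apply/unitrPr; exists h.
  rewrite poly_unitE => /andP[/size_poly1P[c c0 ->]]; rewrite coefC /= => cU.
  have [] : c = 1 \/ c = -1 by move: cU; rewrite qualifE /=; lia.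
    by move=> ->; exists false, [::]; rewrite big_nil mulr1.
  by move=> ->; exists true, [::]; rewrite big_nil mulr1 polyCN.
rewrite big_cons => fhE.
have {}IHs := fun f' h' => IHs f' h' (fun x xs => s_gt0 x (mem_behead (s := d :: s) xs)).
have [] := @Cyclotomic_prime d f h; first by apply: s_gt0; rewrite mem_head.
- by exists (\prod_(x <- s) 'Phi_x); rewrite fhE mulrC.
- move=> [g fE]; have [|u [m [sz gE]]] := IHs g h.
    by apply: (mulIf (Cyclotomic_neq0 d)); rewrite mulrAC -fE fhE mulrC.
  exists u, (true :: m); rewrite /= sz big_cons fE gE; split=> //.
  by rewrite mulrC mulrCA.
move=> [g hE]; have [|u [m [sz fE]]] := IHs f g.
  by apply: (mulIf (Cyclotomic_neq0 d)); rewrite -mulrA -hE fhE mulrC.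
by exists u, (false :: m); rewrite /= sz.
Qed.

Lemma height_leP (f : {poly int}) (m : nat) :
  reflect (forall n, `|(f`_n)%R|%N <= m)%N (height f <= m)%N.
Proof.
apply: (iffP (bigmax_leqP _ _ _)) => [hf n|hf i _]; last exact: hf.
have [n_lt|n_ge] := ltnP n (size f); first exact: (hf (Ordinal n_lt)).
by rewrite nth_default.
Qed.

Lemma abs_coef_signM (u : bool) (f : {poly int}) n :
  `|(((-1) ^+ u * f)`_n)%R|%N = `|(f`_n)%R|%N.
Proof. by case: u; rewrite ?mul1r // mulN1r coefN abszN. Qed.

Lemma perm_divisors_pfactor q i : prime q ->
  perm_eq (divisors (q ^ i)) [seq (q ^ j)%N | j <- iota 0 i.+1].
Proof.
move=> pr_q; apply: uniq_perm; first exact: divisors_uniq.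
  by rewrite map_inj_uniq ?iota_uniq //; apply/expnI/prime_gt1.
move=> d; rewrite -dvdn_divisors ?expn_gt0 ?prime_gt0 //.
apply/dvdn_pfactor/mapP => // -[j]; rewrite ?mem_iota ?add0n => ji ->; exists j => //.
by rewrite mem_iota.
Qed.

Lemma perm_divisors_pqfactor p q i : prime p -> prime q -> p != q ->
  perm_eq (divisors (p * q ^ i))
    ([seq (q ^ j)%N | j <- iota 0 i.+1] ++ [seq (p * q ^ j)%N | j <- iota 0 i.+1]).
Proof.
move=> pr_p pr_q pq; have p_gt0 := prime_gt0 pr_p; have q_gt1 := prime_gt1 pr_q.
have pNdvd j : ~~ (p %| q ^ j)%N.
  by rewrite Euclid_dvdX // dvdn_prime2 // (negPf pq).
have qinj : injective (expn q) by exact: expnI.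
apply: uniq_perm; first exact: divisors_uniq.
  rewrite cat_uniq !map_inj_uniq ?iota_uniq ?andbT //; last first.
    by move=> j k /eqP; rewrite eqn_pmul2l // => /eqP/qinj.
  apply/hasPn => _ /mapP[j _ ->]; apply/mapP => -[k _ E].
  by have := pNdvd k; rewrite -E dvdn_mulr.
move=> d; rewrite -dvdn_divisors ?muln_gt0 ?expn_gt0 ?p_gt0 ?prime_gt0 // mem_cat.
have qP d' : (d' %| q ^ i)%N = (d' \in [seq (q ^ j)%N | j <- iota 0 i.+1]).
  by rewrite dvdn_divisors ?expn_gt0 ?prime_gt0 // (perm_mem (perm_divisors_pfactor i pr_q)).
have [/dvdnP[d' ->]|pNd] := boolP (p %| d)%N.
  rewrite mulnC dvdn_pmul2l // qP.
  have /negPf-> : (p * d')%N \notin [seq (q ^ j)%N | j <- iota 0 i.+1].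
    by apply/mapP => -[j _ E]; have := pNdvd j; rewrite -E dvdn_mulr.
  rewrite orFb; apply/mapP/mapP => -[j jP E]; exists j => //; first by rewrite E.
  by apply/eqP; rewrite -(eqn_pmul2l p_gt0) E.
rewrite Gauss_dvdr ?qP; last by rewrite coprime_sym prime_coprime.
have /negPf-> : d \notin [seq (p * q ^ j)%N | j <- iota 0 i.+1].
  by apply/mapP => -[j _ E]; rewrite E dvdn_mulr in pNd.
by rewrite orbF.
Qed.

Section Words.
Variables p q : nat.
Hypotheses (pr_p : prime p) (pr_q : prime q) (p_neq_q : p != q).

Let q_gt0 : (0 < q)%N. Proof. exact: prime_gt0. Qed.
Let p_gt0 : (0 < p)%N. Proof. exact: prime_gt0. Qed.

Lemma Cyclotomic1 : 'Phi_1 = 'X - 1 :> {poly int}.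
Proof. by have := @prod_Cyclotomic 1 isT; rewrite big_seq1. Qed.

Lemma Cyclotomic_pfactorS i :
  ('X^(q ^ i) - 1) * 'Phi_(q ^ i.+1) = 'X^(q ^ i.+1) - 1 :> {poly int}.
Proof.
have E j : 'X^(q ^ j) - 1 = \prod_(k <- iota 0 j.+1) 'Phi_(q ^ k) :> {poly int}.
  rewrite -prod_Cyclotomic ?expn_gt0 ?q_gt0 //.
  by rewrite (perm_big _ (perm_divisors_pfactor j pr_q)) big_map.
by rewrite !E -(addn1 i.+1) iotaD big_cat /= big_seq1.
Qed.

Lemma Cyclotomic_pqfactorS i :
  ('X^(p * q ^ i) - 1) * 'Phi_(q ^ i.+1) * 'Phi_(p * q ^ i.+1) =
  'X^(p * q ^ i.+1) - 1 :> {poly int}.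
Proof.
have E j : 'X^(p * q ^ j) - 1 = (\prod_(k <- iota 0 j.+1) 'Phi_(q ^ k)) *
    \prod_(k <- iota 0 j.+1) 'Phi_(p * q ^ k) :> {poly int}.
  rewrite -prod_Cyclotomic ?muln_gt0 ?expn_gt0 ?q_gt0 ?p_gt0 //.
  by rewrite (perm_big _ (perm_divisors_pqfactor j pr_p pr_q p_neq_q)) big_cat !big_map.
by rewrite !E -(addn1 i.+1) iotaD !big_cat /= !big_seq1; ring.
Qed.

Lemma Cyclotomic_prime_mul : ('X - 1) * 'Phi_p = 'X^p - 1 :> {poly int}.
Proof.
rewrite -(@prod_Cyclotomic p) // -Cyclotomic1.
have := perm_divisors_pfactor 1 pr_p; rewrite expn1 => E.
by rewrite (perm_big _ E) /= !big_cons big_nil mulr1 expn1.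
Qed.

Lemma Cyclotomic_pfactor_comp i :
  'Phi_(q ^ i.+1) \Po 'X^q = 'Phi_(q ^ i.+2) :> {poly int}.
Proof.
apply: (mulfI (Xnsub1_neq0 (_ : 0 < q ^ i.+1)%N)); first by rewrite expn_gt0 q_gt0.
rewrite Cyclotomic_pfactorS.
have /(congr1 (comp_poly 'X^q)) := Cyclotomic_pfactorS i.
rewrite rmorphM !rmorphB !rmorph1 /= !comp_Xn_poly -!exprM -!expnS => <-.
by [].
Qed.

Lemma Cyclotomic_pqfactor_comp i :
  'Phi_(p * q ^ i.+1) \Po 'X^q = 'Phi_(p * q ^ i.+2) :> {poly int}.
Proof.
have X0 := Xnsub1_neq0 (_ : 0 < p * q ^ i.+1)%N.
have n0 : ('X^(p * q ^ i.+1) - 1) * 'Phi_(q ^ i.+2) != 0 :> {poly int}.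
  by rewrite mulf_neq0 ?Cyclotomic_neq0 ?X0 // muln_gt0 expn_gt0 p_gt0 q_gt0.
apply: (mulfI n0); rewrite Cyclotomic_pqfactorS.
have /(congr1 (comp_poly 'X^q)) := Cyclotomic_pqfactorS i.
rewrite !rmorphM !rmorphB !rmorph1 /= !comp_Xn_poly Cyclotomic_pfactor_comp -!exprM.
have E j : (q * (p * q ^ j) = p * q ^ j.+1)%N by rewrite mulnCA -expnS.
by rewrite !E => <-.
Qed.

Lemma Cyclotomic_prime_comp :
  'Phi_p \Po 'X^q = 'Phi_p * 'Phi_(p * q) :> {poly int}.
Proof.
apply: (mulfI (Xnsub1_neq0 q_gt0)).
have /(congr1 (comp_poly 'X^q)) := Cyclotomic_prime_mul.
rewrite rmorphM !rmorphB !rmorph1 /= comp_polyX comp_Xn_poly -exprM => ->.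
have := Cyclotomic_pqfactorS 0; rewrite !expn0 !expn1 !muln1 -Cyclotomic_prime_mul.
have := Cyclotomic_pfactorS 0; rewrite !expn0 !expn1 expr1 => <-.
by rewrite mulnC => <-; ring.
Qed.

(* Normalised so that the constant coefficient of every factor is 1. *)
Definition psi n : {poly int} := if n == 1%N then 1 - 'X else 'Phi_n.

Fixpoint wpoly i (w : seq (bool * bool)) : {poly int} :=
  if w is (e, f) :: w' then
    psi (q ^ i)%N ^+ e * 'Phi_(p * q ^ i) ^+ f * wpoly i.+1 w'
  else 1.

Lemma psi1 : psi 1 = 1 - 'X. Proof. by []. Qed.

Lemma psiS i : psi (q ^ i.+1)%N = 'Phi_(q ^ i.+1).
Proof. by rewrite /psi gtn_eqF // -(exp1n i.+1) ltn_exp2r ?prime_gt1. Qed.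

Lemma psi_sign n : exists u : bool, psi n = (-1) ^+ u * 'Phi_n.
Proof.
rewrite /psi; case: eqP => [->|_]; last by exists false; rewrite mul1r.
by exists true; rewrite Cyclotomic1; ring.
Qed.

Lemma wpoly_comp i w : wpoly i.+1 w \Po 'X^q = wpoly i.+2 w.
Proof.
elim: w i => [|[e f] w IHw] i /=; first by rewrite rmorph1.
rewrite !rmorphM !rmorphXn /= IHw !psiS Cyclotomic_pfactor_comp.
by rewrite Cyclotomic_pqfactor_comp.
Qed.

(** Substituting [X^q] merely shifts the factors of index at least 1, whereas [1 - 'X] and ['Phi_p]
    also leave a copy of themselves. Because of this leftover, a letter acts through the change of
    its exponents. *)
Lemma wpoly0_comp w : wpoly 0 w \Po 'X^q =
  (1 - 'X) ^+ (head (false, false) w).1 * 'Phi_p ^+ (head (false, false) w).2 * wpoly 1 w.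
Proof.
case: w => [|[e f] w] /=; first by rewrite rmorph1 !mul1r.
rewrite !rmorphM !rmorphXn /= wpoly_comp expn0 muln1 psi1 Cyclotomic_prime_comp.
rewrite psiS expn1 rmorphB rmorph1 /= comp_polyX.
have -> : 1 - 'X^q = (1 - 'X) * 'Phi_q :> {poly int}.
  by have := Cyclotomic_pfactorS 0; rewrite !expn1 => E; rewrite -[LHS]opprB -E; ring.
by rewrite !exprMn; ring.
Qed.

Fixpoint dseq i n : seq nat :=
  if n is n'.+1 then (q ^ i)%N :: (p * q ^ i)%N :: dseq i.+1 n' else [::].

Lemma dseq_gt0 i n d : d \in dseq i n -> (0 < d)%N.
Proof.
elim: n i => //= n IHn i; rewrite !inE.
by case/or3P => [/eqP->|/eqP->|/IHn//]; rewrite ?muln_gt0 expn_gt0 ?p_gt0 q_gt0.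
Qed.

Lemma prod_dseq b : \prod_(d <- dseq 0 b.+1) 'Phi_d = 'X^(p * q ^ b) - 1 :> {poly int}.
Proof.
rewrite -prod_Cyclotomic ?muln_gt0 ?expn_gt0 ?q_gt0 ?p_gt0 //.
rewrite (perm_big _ (perm_divisors_pqfactor b pr_p pr_q p_neq_q)) big_cat -[RHS]/(_ * _) !big_map.
elim: b.+1 0%N => [|n IHn] i; first by rewrite !big_nil mulr1.
by rewrite /= !big_cons IHn; ring.
Qed.

Lemma mask_dseq_wpoly n i m : size m = size (dseq i n) ->
  exists (u : bool) w, size w = n /\
    \prod_(d <- mask m (dseq i n)) 'Phi_d = (-1) ^+ u * wpoly i w.
Proof.
elim: n i m => [|n IHn] i m; first by exists false, [::]; rewrite mask0 big_nil mul1r.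
case: m => [|e [|f m]] //= [/IHn[u [w [sz wE]]]].
have [v vE] := psi_sign (q ^ i)%N.
exists (u (+) (e && v)), ((e, f) :: w); split; first by rewrite /= sz.
rewrite /= signr_addb vE; case: e f => [] [] /=; rewrite ?big_cons wE ?expr0 ?expr1;
  case: (v) => /=; ring.
Qed.

Lemma dvdpZ_wpoly b (f : {poly int}) : dvdpZ f ('X^(p * q ^ b) - 1) ->
  exists (u : bool) w, size w = b.+1 /\ f = (-1) ^+ u * wpoly 0 w.
Proof.
move=> [h hE]; have := @dvdpZ_prod_Cyclotomic (dseq 0 b.+1) f h.
rewrite prod_dseq mulrC => -[||u [m [/mask_dseq_wpoly[v [w [sz ->]]] ->]]] //.
  by move=> d /dseq_gt0.
by exists (u (+) v), w; rewrite signr_addb mulrA.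
Qed.

Lemma wpoly_dvdpZ b w : size w = b.+1 ->
  dvdpZ (wpoly 0 w) ('X^(p * q ^ b) - 1).
Proof.
rewrite -prod_dseq; elim: w b.+1 0%N => [|[e f] w IHw] [|n] i //= => [_|[sz]].
  by exists 1; rewrite mulr1 big_nil.
have [h hE] := IHw _ i.+1 sz; rewrite !big_cons hE; have [v vE] := psi_sign (q ^ i)%N.
exists ((-1) ^+ (v && e) * 'Phi_(q ^ i) ^+ (~~ e) * 'Phi_(p * q ^ i) ^+ (~~ f) * h).
by rewrite vE; case: e f (v) => [] [] [] /=; ring.
Qed.

Lemma wpoly_rcons00 i w : wpoly i (rcons w (false, false)) = wpoly i w.
Proof. by elim: w i => [|[e f] w IHw] i /=; rewrite ?mul1r // IHw. Qed.
End Words.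

(** * Power series acting on sequences *)

(* The coefficients of [g] times the generating series of [T]. *)
Definition act (g : {poly int}) (T : nat -> int) (n : nat) : int :=
  \sum_(i < n.+1) g`_i * T (n - i)%N.

Lemma actE g T n N : (n < N)%N -> act g T n = (g * \poly_(i < N) T i)`_n.
Proof.
move=> nN; rewrite coefM; apply: eq_bigr => i _.
by rewrite coef_poly (leq_ltn_trans _ nN) ?leq_subr.
Qed.

Lemma act_ext g T U n : (forall i, (i <= n)%N -> T i = U i) -> act g T n = act g U n.
Proof. by move=> TU; apply: eq_bigr => i _; rewrite TU ?leq_subr. Qed.

Lemma act_mul g h T n : act (g * h) T n = act g (act h T) n.
Proof.
rewrite !(actE _ _ (ltnSn n)) -mulrA !coefM; apply: eq_bigr => i _.
have lt_n : (n - i < n.+1)%N by rewrite ltnS leq_subr.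
by rewrite coef_poly lt_n (actE _ _ lt_n).
Qed.

Lemma act1 T n : act 1 T n = T n.
Proof. by rewrite (actE _ _ (ltnSn n)) mul1r coef_poly ltnSn. Qed.

Lemma actD g h T n : act (g + h) T n = act g T n + act h T n.
Proof. by rewrite !(actE _ _ (ltnSn n)) mulrDl coefD. Qed.

Lemma actN g T n : act (- g) T n = - act g T n.
Proof. by rewrite !(actE _ _ (ltnSn n)) mulNr coefN. Qed.

Lemma actC c T n : act c%:P T n = c * T n.
Proof. by rewrite (actE _ _ (ltnSn n)) coefCM coef_poly ltnSn. Qed.

Lemma actXn k T n : act 'X^k T n = if (k <= n)%N then T (n - k)%N else 0.
Proof.
rewrite (actE _ _ (ltnSn n)) coefXnM [(k <= n)%N]leqNgt; case: ltnP => //= kn.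
by rewrite coef_poly ltnS leq_subr.
Qed.

Lemma act_inj (g : {poly int}) T U : g`_0 = 1 -> act g T =1 act g U -> T =1 U.
Proof.
move=> g0 E; elim/ltn_ind => n IHn; move: (E n).
rewrite /act !big_ord_recl /= g0 !mul1r !subn0 => /eqP.
rewrite -subr_eq => /eqP <-; rewrite -addrA -sumrB big1 ?addr0 // => i _.
by rewrite IHn ?subrr // /bump /=; case: i => i /=; lia.
Qed.

(** Only exponents divisible by [q] occur in [g(X^q)], so the residue classes of indices modulo [q]
    do not interact and [g] acts on each of them separately. *)
Lemma act_comp q g U m n : (0 < q)%N -> (m < q)%N ->
  act (g \Po 'X^q) U (m + q * n) = act g (fun j => U (m + q * j)%N) n.
Proof.
move=> q0 mq; elim/poly_ind: g U n => [|g c IHg] U n.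
  by rewrite comp_poly0 /act !big1 // => i _; rewrite coef0 mul0r.
rewrite comp_polyD comp_polyM comp_polyX comp_polyC !actD !actC !act_mul IHg.
congr (_ + _); apply: act_ext => i _; rewrite !actXn -['X]expr1 !actXn.
case: i => [|i] /=; first by rewrite muln0 addn0 leqNgt mq.
have -> : (q <= m + q * i.+1)%N by rewrite mulnS; lia.
by congr U; rewrite mulnS; lia.
Qed.

Definition diff (T : nat -> int) n : int := T n - (if n is n'.+1 then T n' else 0).
Definition cum (T : nat -> int) n : int := \sum_(i < n.+1) T i.

Lemma act_diff T n : act (1 - 'X) T n = diff T n.
Proof. by rewrite actD actN act1 -['X]expr1 actXn; case: n => //= n; rewrite subn1. Qed.

Lemma cumS T n : cum T n.+1 = cum T n + T n.+1.
Proof. by rewrite /cum big_ord_recr. Qed.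

Lemma cum0 T : cum T 0 = T 0%N.
Proof. by rewrite /cum big_ord1. Qed.

Lemma diff_cum T n : diff (cum T) n = T n.
Proof. by case: n => [|n]; rewrite /diff ?cum0 ?subr0 // cumS addrAC subrr add0r. Qed.

Section Ops.
Variable p : nat.
Hypothesis (pr_p : prime p).
Let p_gt0 : (0 < p)%N. Proof. exact: prime_gt0. Qed.

(** Multiplication by ['Phi_p], the sum of the last [p] terms; in this form it is [gap (cum T)] by
    unfolding. *)
Definition win (T : nat -> int) n : int :=
  cum T n - (if (p <= n)%N then cum T (n - p) else 0).

Definition gap (T : nat -> int) n : int :=
  T n - (if (p <= n)%N then T (n - p)%N else 0).

Lemma act_gap T n : act (1 - 'X^p) T n = gap T n.
Proof. by rewrite actD actN act1 actXn. Qed.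

Lemma Cyclotomic_gap : (1 - 'X) * 'Phi_p = 1 - 'X^p :> {poly int}.
Proof. by have E := Cyclotomic_prime_mul pr_p; rewrite -[RHS]opprB -E; ring. Qed.

Lemma act_win T n : act 'Phi_p T n = win T n.
Proof.
rewrite -[RHS]/(gap (cum T) n) -act_gap -Cyclotomic_gap mulrC act_mul.
by apply: act_ext => i _; rewrite act_diff diff_cum.
Qed.

Definition pext (N : nat -> int) n : int := N (n %% p)%N.

Lemma gap_pext N n : gap (pext N) n = if (n < p)%N then N n else 0.
Proof.
rewrite /gap /pext leqNgt; case: ltnP => /= [np|np]; first by rewrite modn_small ?subr0.
by rewrite -[in X in X - _](subnK np) modnDr subrr.
Qed.

(* The exponents of the letter are the decreases of the two indicators. *)
Definition letter (e e' f f' : bool) (T U : nat -> int) : Prop :=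
  act ((1 - 'X) ^+ (e && ~~ e') * 'Phi_p ^+ (f && ~~ f')) T =1
  act ((1 - 'X) ^+ (~~ e && e') * 'Phi_p ^+ (~~ f && f')) U.

Lemma letterP e e' f f' T U : letter e e' f f' T U ->
  act ((1 - 'X) ^+ e * 'Phi_p ^+ f) T =1 act ((1 - 'X) ^+ e' * 'Phi_p ^+ f') U.
Proof.
move=> L n; pose h : {poly int} := (1 - 'X) ^+ (e && e') * 'Phi_p ^+ (f && f').
transitivity (act h (act ((1 - 'X) ^+ (e && ~~ e') * 'Phi_p ^+ (f && ~~ f')) T) n).
  by rewrite -act_mul; congr act; rewrite /h; case: e e' f f' {L h} => [] [] [] [] /=; ring.
rewrite (act_ext _ (fun i _ => L i)) -act_mul.
by congr act; rewrite /h; case: e e' f f' {L h} => [] [] [] [] /=; ring.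
Qed.

Lemma letter00 e f T : letter e e f f T T.
Proof. by move=> n; rewrite !andbN !andNb !mul1r. Qed.

Lemma letterP0 f T : letter true false f f T (diff T).
Proof. by move=> n; rewrite !andbN !andNb /= !mulr1 expr1 act1 act_diff. Qed.

Lemma letterN0 f T : letter false true f f T (cum T).
Proof. by move=> n; rewrite !andbN !andNb /= !mulr1 expr1 act1 act_diff diff_cum. Qed.

Lemma letter0P e T : letter e e true false T (win T).
Proof. by move=> n; rewrite !andbN !andNb /= !mul1r expr1 act1 act_win. Qed.

Lemma letterPP T : letter true false true false T (gap T).
Proof. by move=> n; rewrite /= !mul1r !expr1 Cyclotomic_gap act_gap act1. Qed.

Lemma letterNP T : letter false true true false T (win (cum T)).
Proof.
move=> n; rewrite /= !mul1r !expr1 mulr1 -(act_ext _ (fun i _ => act_win (cum T) i)).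
by rewrite -act_mul mulrC act_mul; apply: act_ext => i _; rewrite act_diff diff_cum.
Qed.

(** Since [1 / Phi_p = (1 - X) / (1 - X^p)], division by ['Phi_p] costs one more difference,
    followed by periodic extension when the differenced sequence fits in one period. The total
    exponent [1 + e - e'] of [1 - 'X] is never truncated. *)
Lemma letter_pext (e e' : bool) T N : N =1 iter (1 + e - e') diff T ->
  (forall n, (p <= n)%N -> N n = 0) -> letter e e' false true T (pext N).
Proof.
move=> NE N0 n; rewrite /= expr1.
have actU i : act ((1 - 'X) * 'Phi_p) (pext N) i = N i.
  by rewrite Cyclotomic_gap act_gap gap_pext; case: ltnP => // /N0.
have A0 : (1 - 'X : {poly int})`_0 = 1 by rewrite coefB coef1 coefX subr0.
case: e e' NE => [] [] NE; rewrite /= ?expr0 ?expr1 ?mulr1 ?mul1r.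
- move: n; apply: (act_inj A0) => n; rewrite -!act_mul actU NE mulr1 act_diff.
  by [].
- move: n; apply: (act_inj A0) => n; rewrite -[RHS]act_mul actU NE /= act_diff /diff.
  by case: n => [|n]; rewrite !act_diff.
- by rewrite actU NE /= act1.
move: n; apply: (act_inj A0) => n; rewrite -!act_mul actU NE mulr1 act_diff.
by [].
Qed.

End Ops.

Definition sec (q m : nat) (U : nat -> int) (j : nat) : int := U (m + q * j)%N.

Lemma act_wpoly_cons p q e f w T U m n : prime p -> prime q -> p != q -> (m < q)%N ->
  letter p e (head (false, false) w).1 f (head (false, false) w).2 T U ->
  act (wpoly p q 0 ((e, f) :: w)) T (m + q * n) = act (wpoly p q 0 w) (sec q m U) n.
Proof.
move=> pr_p pr_q pq mq /letterP L; rewrite /= expn0 muln1 psi1.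
rewrite mulrC act_mul (act_ext _ (fun i _ => L i)) -act_mul mulrC.
by rewrite -(wpoly0_comp pr_p pr_q pq) act_comp ?prime_gt0.
Qed.

(** * Palindromicity and reversal of periodic states *)

Definition prev (f : {poly int}) : {poly int} :=
  \poly_(i < size f) f`_((size f).-1 - i).

Lemma prevM (f g : {poly int}) : f != 0 -> g != 0 -> prev (f * g) = prev f * prev g.
Proof.
(* [prev] is not additive, as degrees can drop. Reversal with respect to a fixed degree is linear,
   which reduces the product to monomials times [g]. *)
pose revd d (h : {poly int}) : {poly int} := \poly_(i < d.+1) h`_(d - i).
have prevE h : h != 0 -> prev h = revd (size h).-1 h.
  by rewrite -size_poly_gt0 => h0; rewrite /prev /revd prednK.
move=> f0 g0; rewrite !prevE ?mulf_neq0 // size_mul //.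
have [f_gt0 g_gt0] : (0 < size f)%N /\ (0 < size g)%N by rewrite !size_poly_gt0.
set d := (size f).-1; set e := (size g).-1.
have -> : (size f + size g).-1.-1 = (d + e)%N by rewrite /d /e; lia.
have revXM i : (i <= d)%N -> revd (d + e)%N ('X^i * g) = 'X^(d - i) * revd e g.
  move=> id; apply/polyP => k; rewrite coef_poly coefXnM [RHS]coefXnM coef_poly.
  case: (ltnP k (d - i)) => k1; case: (ltnP k (d + e).+1) => k2;
    case: (ltnP (d + e - k) i) => k3 //.
  - have eE : e.+1 = size g by rewrite /e prednK.
    by rewrite nth_default // -eE; clear -k1 k2 k3 id; lia.
  - by case: ltnP => // k4; lia.
  - case: ltnP => k4; first by congr nth; lia.
    by lia.
  - by case: ltnP => // k4; lia.
  - by case: ltnP => // k4; lia.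
have revdD n h k : revd n (h + k) = revd n h + revd n k.
  by apply/polyP => i; rewrite coefD !coef_poly coefD; case: ifP => //; rewrite addr0.
have revdZ n c h : revd n (c *: h) = c *: revd n h.
  by apply/polyP => i; rewrite coefZ !coef_poly coefZ; case: ifP => //; rewrite mulr0.
have revd0 n : revd n 0 = 0.
  by apply/polyP => i; rewrite coef_poly !coef0; case: ifP.
have revd_sum n m (F : nat -> {poly int}) :
    revd n (\sum_(i < m) F i) = \sum_(i < m) revd n (F i).
  by elim: m => [|m IHm]; rewrite ?big_ord0 // !big_ord_recr /= revdD IHm.
have fE : f = \sum_(i < d.+1) f`_i *: 'X^i by rewrite -poly_def prednK // coefK.
have -> : revd d f = \sum_(i < d.+1) f`_i *: 'X^(d - i).
  apply/polyP => k; rewrite coef_poly coef_sum.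
  case: ltnP => kd.
    have kd' : (d - k < d.+1)%N by rewrite ltnS leq_subr.
    rewrite (bigD1 (Ordinal kd')) //= coefZ coefXn subKn // eqxx mulr1 big1 ?addr0 // => i.
    rewrite -val_eqE /= => ik; rewrite coefZ coefXn; case: eqP => [E|]; last by rewrite mulr0.
    by case/eqP: ik; case: i E => /= i; lia.
  rewrite big1 // => i _; rewrite coefZ coefXn; case: eqP => [E|]; last by rewrite mulr0.
  by case: i E => /= i; lia.
have -> : f * g = \sum_(i < d.+1) (f`_i *: 'X^i * g) by rewrite {1}fE mulr_suml.
rewrite mulr_suml (revd_sum _ _ (fun i => f`_i *: 'X^i * g)); apply: eq_bigr => i _.
by rewrite -!scalerAl revdZ revXM // -ltnS.
Qed.

Definition palindromic (f : {poly int}) := exists u : bool, prev f = (-1) ^+ u * f.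

Lemma palindromicM f g : f != 0 -> g != 0 ->
  palindromic f -> palindromic g -> palindromic (f * g).
Proof.
move=> f0 g0 [u fE] [v gE]; exists (u (+) v).
by rewrite prevM // fE gE signr_addb; ring.
Qed.

Lemma palindromic_divl f g : f != 0 -> g != 0 ->
  palindromic f -> palindromic (f * g) -> palindromic g.
Proof.
move=> f0 g0 [u fE] [v]; rewrite prevM // fE => E; exists (u (+) v).
apply: (mulfI f0); rewrite signr_addb.
have -> : f * prev g = (-1) ^+ u * ((-1) ^+ u * f * prev g).
  by rewrite !mulrA -signr_addb addbb mul1r.
by rewrite E; ring.
Qed.

Lemma palindromic_coef f : palindromic f ->
  exists u : bool, forall i, (i <= (size f).-1)%N -> f`_i = (-1) ^+ u * f`_((size f).-1 - i).
Proof.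
move=> [u fE]; exists u => i id.
have [->|f0] := eqVneq f 0; first by rewrite !coef0 mulr0.
have := congr1 (fun g : {poly int} => g`_((size f).-1 - i)) fE.
rewrite /prev coef_poly subKn //.
have -> : ((size f).-1 - i < size f)%N by move: f0; rewrite -size_poly_gt0; lia.
by move=> ->; case: u {fE}; rewrite ?mulN1r ?mul1r // coefN.
Qed.

Lemma palindromic_Xnsub1 n : (0 < n)%N -> palindromic ('X^n - 1).
Proof.
move=> n0; exists true; rewrite expr1 mulN1r opprB; apply/polyP => i.
rewrite coef_poly size_XnsubC // /= !coefB !coefXn !coef1.
case: ltnP => i_n.
  have -> : (n - i == n)%N = (i == 0)%N by lia.
  by have -> : (n - i == 0)%N = (i == n)%N by lia.
have -> : (i == 0)%N = false by lia.
by have -> : (i == n)%N = false by lia.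
Qed.

Lemma palindromicN f : palindromic f -> palindromic (- f).
Proof.
move=> [u fE]; exists u; rewrite mulrN -fE; apply/polyP => i.
by rewrite coefN !coef_poly size_polyN coefN; case: ifP => //; rewrite oppr0.
Qed.

Lemma palindromic_1 : palindromic 1.
Proof.
exists false; rewrite mul1r; apply/polyP => i; rewrite coef_poly size_poly1 coef1 /=.
by case: i => [|i] //=; rewrite coef1.
Qed.

Section WordPalindromic.
Variables p q : nat.
Hypotheses (pr_p : prime p) (pr_q : prime q) (p_neq_q : p != q).
Let q_gt0 : (0 < q)%N. Proof. exact: prime_gt0. Qed.
Let p_gt0 : (0 < p)%N. Proof. exact: prime_gt0. Qed.

Lemma palindromic_psi i : palindromic (psi (q ^ i)%N).
Proof.
case: i => [|i].
  rewrite expn0 psi1 -opprB -['X]expr1; apply: palindromicN.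
  exact: palindromic_Xnsub1.
rewrite psiS //; apply: (palindromic_divl (Xnsub1_neq0 (_ : 0 < q ^ i)%N)).
- by rewrite expn_gt0 q_gt0.
- exact: Cyclotomic_neq0.
- by apply: palindromic_Xnsub1; rewrite expn_gt0 q_gt0.
by rewrite Cyclotomic_pfactorS //; apply: palindromic_Xnsub1; rewrite expn_gt0 q_gt0.
Qed.

Lemma palindromic_pq i : palindromic 'Phi_(p * q ^ i).
Proof.
case: i => [|i].
  rewrite expn0 muln1; apply: (palindromic_divl (Xnsub1_neq0 (isT : 0 < 1)%N)).
  - exact: Cyclotomic_neq0.
  - exact: palindromic_Xnsub1.
  by rewrite expr1 Cyclotomic_prime_mul //; apply: palindromic_Xnsub1.
have Y0 j : (0 < p * q ^ j)%N by rewrite muln_gt0 expn_gt0 p_gt0 q_gt0.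
apply: (@palindromic_divl (('X^(p * q ^ i) - 1) * 'Phi_(q ^ i.+1))).
- by rewrite mulf_neq0 ?Cyclotomic_neq0 ?Xnsub1_neq0 ?Y0.
- exact: Cyclotomic_neq0.
- apply: palindromicM; rewrite ?Cyclotomic_neq0 ?Xnsub1_neq0 ?Y0 //.
    exact: palindromic_Xnsub1.
  by rewrite -psiS //; exact: palindromic_psi.
by rewrite Cyclotomic_pqfactorS //; apply: palindromic_Xnsub1.
Qed.

Lemma psi_neq0 n : psi n != 0.
Proof.
rewrite /psi; case: ifP => _; last exact: Cyclotomic_neq0.
by rewrite -opprB oppr_eq0 -['X]expr1 Xnsub1_neq0.
Qed.

Lemma wpoly_neq0 i w : wpoly p q i w != 0.
Proof.
elim: w i => [|[e f] w IHw] i /=; first exact: oner_neq0.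
by rewrite !mulf_neq0 ?expf_neq0 ?psi_neq0 ?Cyclotomic_neq0.
Qed.

Lemma palindromic_wpoly i w : palindromic (wpoly p q i w).
Proof.
have palX (g : {poly int}) (u : bool) : palindromic g -> palindromic (g ^+ u).
  by case: u => // _; exact: palindromic_1.
elim: w i => [|[e f] w IHw] i /=; first exact: palindromic_1.
have n0 := (psi_neq0 (q ^ i)%N, Cyclotomic_neq0 (p * q ^ i)%N).
apply: palindromicM; rewrite ?wpoly_neq0 ?mulf_neq0 ?expf_neq0 ?n0 //.
apply: palindromicM; rewrite ?expf_neq0 ?n0 //; apply: palX.
  exact: palindromic_psi.
exact: palindromic_pq.
Qed.

End WordPalindromic.

Definition periodic p (T : nat -> int) := forall n, T (n + p)%N = T n.

Section Periodic.
Variable p : nat.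
Hypothesis p_gt0 : (0 < p)%N.

Lemma periodicM T k n : periodic p T -> T (n + p * k)%N = T n.
Proof.
by move=> perT; elim: k => [|k IHk]; rewrite ?muln0 ?addn0 // mulnS addnCA addnC perT.
Qed.

Lemma periodic_mod T n : periodic p T -> T (n %% p)%N = T n.
Proof. by move=> perT; rewrite [in RHS](divn_eq n p) addnC mulnC periodicM. Qed.

Lemma periodic_eqmod T m n : periodic p T -> m = n %[mod p] -> T m = T n.
Proof. by move=> perT E; rewrite -(periodic_mod m perT) E periodic_mod. Qed.

Lemma sum_periodic_shift T m : periodic p T ->
  \sum_(i < p) T (m + i)%N = \sum_(i < p) T i.
Proof.
move=> perT; elim: m => [|m IHm] //; rewrite -IHm.
have : \sum_(i < p.+1) T (m + i)%N = \sum_(i < p) T (m + i)%N + T m.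
  by rewrite big_ord_recr /= perT.
rewrite big_ord_recl addn0 addrC => /addIr <-.
by apply: eq_bigr => i _; rewrite lift0 addnS addSn.
Qed.

(** As [u] is invertible modulo [p], the map [i -> m + u * i] permutes the residues. *)
Lemma sum_periodic_affine (F : nat -> int) m u : coprime u p -> periodic p F ->
  \sum_(i < p) F (m + u * i)%N = \sum_(i < p) F i.
Proof.
move=> cup perF; rewrite -(sum_periodic_shift m perF).
have [-> |p_gt1] : p = 1%N \/ (1 < p)%N by lia.
  by rewrite !big_ord1 muln0.
pose h (i : 'I_p) : 'I_p := Ordinal (ltn_pmod (u * i) p_gt0).
have h_inj : injective h.
  move=> i j /(congr1 val)/= E; apply: val_inj => /=.
  have cpu : coprime p u by rewrite coprime_sym.
  wlog ij : i j E / (i <= j)%N.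
    by move=> W; case: (leqP i j) => [|/ltnW] /W; [apply | move=> /(_ (esym E))->].
  have : (p %| u * (j - i))%N.
    by rewrite mulnBr -eqn_mod_dvd ?leq_mul2l ?ij ?orbT //; apply/eqP.
  rewrite Gauss_dvdr // => /dvdnP[k kE]; have := ltn_ord j; have := ltn_ord i.
  by case: k kE => [|k]; rewrite ?mul0n ?mulSn; lia.
rewrite [RHS](reindex_inj h_inj) /=; apply: eq_bigr => i _.
by apply: periodic_eqmod => //; rewrite modnDmr.
Qed.

Lemma cumB T m n : cum T (m + n) - cum T m = \sum_(i < n) T (m.+1 + i)%N.
Proof.
elim: n => [|n IHn]; first by rewrite addn0 subrr big_ord0.
by rewrite addnS cumS addrAC IHn big_ord_recr /= addSn.
Qed.

Lemma periodic_cum T : periodic p T -> \sum_(i < p) T i = 0 -> periodic p (cum T).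
Proof.
move=> perT T0 n; apply/eqP; rewrite -subr_eq0 cumB.
by rewrite (sum_periodic_shift _ perT) T0.
Qed.

Lemma win_periodic T n : periodic p T -> (p <= n)%N -> win p T n = \sum_(i < p) T i.
Proof.
by move=> perT pn; rewrite /win pn -{1}(subnK pn) cumB sum_periodic_shift.
Qed.

Lemma gap_periodic T n : periodic p T -> (p <= n)%N -> gap p T n = 0.
Proof. by move=> perT pn; rewrite /gap pn -{1}(subnK pn) perT subrr. Qed.

Lemma periodic_pext N : periodic p (pext p N).
Proof. by move=> n; rewrite /pext modnDr. Qed.

Lemma periodic_sec q m U : periodic p U -> periodic p (sec q m U).
Proof.
by move=> perU n; rewrite /sec mulnDr addnA [(q * p)%N]mulnC periodicM.
Qed.

Lemma sum_sec q m U : coprime q p -> periodic p U ->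
  \sum_(i < p) sec q m U i = \sum_(i < p) U i.
Proof. by move=> cqp perU; rewrite sum_periodic_affine. Qed.

End Periodic.

Lemma act_deg (g : {poly int}) T n K : (size g <= K)%N -> (K <= n.+1)%N ->
  act g T n = \sum_(i < K) g`_i * T (n - i)%N.
Proof.
move=> gK Kn; rewrite /act -!(big_mkord xpredT (fun i => g`_i * T (n - i)%N)).
rewrite (big_cat_nat (n := K)) //= -[RHS]addr0; congr (_ + _).
rewrite big_nat big1 // => i /andP[Ki _].
by rewrite nth_default ?mul0r // (leq_trans gK).
Qed.

(** The two-sided periodic extension of [V], read at [-1 - n]. *)
Definition mirror p (V : nat -> int) n : int := V (p.-1 - n %% p)%N.

Section Reversal.
Variables p q : nat.
Hypotheses (pr_p : prime p) (pr_q : prime q) (p_neq_q : p != q).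
Let p_gt0 : (0 < p)%N. Proof. exact: prime_gt0. Qed.

(** From the degree on, all coefficients of the polynomial take part, so the result is [p]-periodic
    in [n]. It also vanishes for large [n]: [(1 - X) Phi_p = 1 - X^p] kills a periodic tail, and
    [Phi_p] alone does so when a period sums to 0. *)
Lemma act_wpoly_vanish e w V n : periodic p V -> (~~ e -> \sum_(i < p) V i = 0) ->
  ((size (wpoly p q 0 ((e, true) :: w))).-1 <= n)%N ->
  act (wpoly p q 0 ((e, true) :: w)) V n = 0.
Proof.
move=> perV sumV; set F := wpoly _ _ _ _; set d := (size F).-1 => dn.
have F0 : F != 0 by exact: wpoly_neq0.
have sF : size F = d.+1 by rewrite /d prednK // size_poly_gt0.
have shift k : act F V (n + p * k) = act F V n.
  rewrite !(@act_deg F V _ d.+1) ?sF //; last by rewrite ltnS (leq_trans dn) ?leq_addr.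
  apply: eq_bigr => i _; rewrite addnC -addnBA; last by rewrite (leq_trans _ dn) // -ltnS.
  by rewrite addnC periodicM.
pose H := wpoly p q 1 w; pose s := size H; rewrite -(shift (1 + s)%N).
have -> : F = H * ((1 - 'X) ^+ e * 'Phi_p).
  by rewrite /F /= expn0 muln1 psi1 expr1 mulrC.
rewrite act_mul {1}/act big1 // => i _.
have [iH|iH] := leqP s i; first by rewrite nth_default // mul0r.
set N := (_ - _)%N; have pN : (p <= N)%N.
  have ps : (s <= p * s)%N by rewrite leq_pmull.
  by rewrite /N; clearbody s; case: i {N} iH => /= i _; rewrite mulnDr muln1; lia.
suff -> : act ((1 - 'X) ^+ e * 'Phi_p) V N = 0 by rewrite mulr0.
case: (e) sumV => /= [_|/(_ isT) sumV].
  by rewrite expr1 Cyclotomic_gap // act_gap gap_periodic.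
by rewrite mul1r act_win // win_periodic.
Qed.

(* Palindromicity of the polynomial and vanishing of its residue class sums
   trade the expansion at 0 for the expansion at infinity. *)
Lemma act_wpoly_mirror e w V n : periodic p V -> (~~ e -> \sum_(i < p) V i = 0) ->
  exists n', `|act (wpoly p q 0 ((e, true) :: w)) V n| =
             `|act (wpoly p q 0 ((e, true) :: w)) (mirror p V) n'|.
Proof.
move=> perV sumV.
have perV' : periodic p (mirror p V) by move=> k; rewrite /mirror modnDr.
have sumV' : ~~ e -> \sum_(i < p) mirror p V i = 0.
  move=> eF; rewrite -[RHS](sumV eF) [RHS](reindex_inj rev_ord_inj) /=; apply: eq_bigr => i _.
  by rewrite /mirror modn_small //; congr V; lia.
have [dn|nd] := leqP (size (wpoly p q 0 ((e, true) :: w))).-1 n.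
  by exists n; rewrite !act_wpoly_vanish.
have van := act_wpoly_vanish (w := w) perV sumV.
have [u uE] := palindromic_coef (palindromic_wpoly pr_p pr_q p_neq_q 0 ((e, true) :: w)).
move: van uE nd; set F := wpoly _ _ _ _; set d := (size F).-1 => van uE nd.
have F0 : F != 0 by exact: wpoly_neq0.
have sF : size F = d.+1 by rewrite /d prednK // size_poly_gt0.
exists (d.-1 - n)%N.
(* Adding [p * d] does not change the periodic [V], and it keeps [n + p * d - i] free of truncation
   for all [i <= d]. The vanishing full sum is then cut after [i = n]; its two parts are
   opposite. *)
have dN : (d <= n + p * d)%N by nia.
have /eqP := van _ dN; rewrite (@act_deg F V _ d.+1) ?sF //.
rewrite -(big_mkord xpredT (fun i => F`_i * V (n + p * d - i)%N)).
rewrite (big_cat_nat (n := n.+1)) /= ?ltnS ?(ltnW nd) // => E.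
suff E1 : \sum_(0 <= i < n.+1) F`_i * V (n + p * d - i)%N = act F V n.
  suff E2 : \sum_(n.+1 <= i < d.+1) F`_i * V (n + p * d - i)%N =
      (-1) ^+ u * act F (mirror p V) (d.-1 - n).
    move: E; rewrite E1 E2 addr_eq0 => /eqP->.
    by rewrite normrN normrM normrX normrN1 expr1n mul1r.
  rewrite -[n.+1]add0n big_addn big_mkord (reindex_inj rev_ord_inj) /= /act mulr_sumr.
  have -> : (d.-1 - n).+1 = (d.+1 - n.+1)%N by lia.
  apply: eq_bigr => i _; have := ltn_ord i; move: (nat_of_ord i) => {}i i_lt.
  have -> : (d.+1 - n.+1 - i.+1 + n.+1 = d - i)%N by lia.
  rewrite (uE (d - i)%N) ?leq_subr // subKn; last by lia.
  rewrite mulrA; congr (_ * _).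
  (* Modulo [p] both arguments are [-1 - t] with [t = d - 1 - n - i]. *)
  rewrite /mirror; apply: periodic_eqmod => //.
  set t := (d.-1 - n - i)%N.
  have tE := divn_eq t p; have tp := ltn_pmod t p_gt0.
  have -> : (n + p * d - (d - i) = p * (d.-1 - t %/ p) + (p.-1 - t %% p))%N.
    move: tE tp; set a := (t %/ p)%N; set b := (t %% p)%N => tE tp.
    have ad : (a < d)%N by rewrite /t in tE; nia.
    have apd : (a * p + p <= p * d)%N by rewrite addnC -mulSn mulnC leq_mul2l ad orbT.
    have dpd : (d <= p * d)%N by rewrite leq_pmull.
    have -> : (p * (d.-1 - a) = p * d - p - a * p)%N.
      by rewrite mulnBr -subn1 mulnBr muln1 [(a * p)%N]mulnC.
    rewrite /t in tE; clear -tE tp apd dpd i_lt nd.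
    move: (a * p)%N (p * d)%N tE apd dpd => X Y tE apd dpd.
    have dE : (X + b + n + i).+1 = d by clear -tE nd i_lt; lia.
    have -> : (d - i = (X + b + n).+1)%N by rewrite -dE; clear; lia.
    have -> : (n + Y - (X + b + n).+1 = Y - (X + b).+1)%N by clear; lia.
    by clear -apd tp; lia.
  by rewrite mulnC modnMDl.
rewrite big_mkord /act; apply: eq_bigr => i _; congr (_ * _).
rewrite addnC -addnBA; last by rewrite -ltnS.
by rewrite addnC periodicM.
Qed.
End Reversal.

(** * Words with the same coefficients for [q] and [r] *)

Definition next (w : seq (bool * bool)) := head (false, false) w.

(* [g] says that the last change of the [f_i] was from 0 to 1, which makes the
   state periodic; multiplying it by [1 - 'X] would alter its first term only. *)
Fixpoint good (g : bool) (w : seq (bool * bool)) : bool :=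
  if w is (e, f) :: w' then
    let: (e', f') := next w' in
    ~~ [&& g, f == f', e & ~~ e'] && good (if f == f' then g else f') w'
  else true.

Lemma diff_tail T n : (forall n, (0 < n)%N -> T n = T 1%N) -> (1 < n)%N -> diff T n = 0.
Proof. by move=> evT; case: n => [|[|n]] // _; rewrite /diff !evT // subrr. Qed.

Lemma sum_diff T n : \sum_(i < n.+1) diff T i = T n.
Proof.
elim: n => [|n IHn]; first by rewrite big_ord1 /diff subr0.
by rewrite big_ord_recr /= IHn /diff addrC subrK.
Qed.

Section Simulation.
Variables p q r : nat.
Hypotheses (pr_p : prime p) (pr_q : prime q) (pr_r : prime r).
Hypotheses (odd_p : odd p) (odd_q : odd q) (odd_r : odd r) (pq : (p < q)%N) (pr : (p < r)%N).
Hypothesis qr : q = r %[mod p] \/ (p %| q + r)%N.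

Let p_gt0 : (0 < p)%N. Proof. exact: prime_gt0. Qed.
Let p_gt2 : (2 < p)%N. Proof. by rewrite odd_prime_gt2. Qed.
Let p_neq_q : p != q. Proof. by rewrite ltn_eqF. Qed.
Let p_neq_r : p != r. Proof. by rewrite ltn_eqF. Qed.
Let p1_lt_q : (p.+1 < q)%N.
Proof. by have : q != p.+1; [apply/eqP => E; move: odd_q; rewrite E /= odd_p | lia]. Qed.
Let p1_lt_r : (p.+1 < r)%N.
Proof. by have : r != p.+1; [apply/eqP => E; move: odd_r; rewrite E /= odd_p | lia]. Qed.
Let q_gt0 : (0 < q)%N. Proof. exact: prime_gt0. Qed.
Let cqp : coprime q p. Proof. by rewrite prime_coprime // dvdn_prime2 // eq_sym. Qed.

(** The extra condition for exponent [e = 0] prepares a later division by [1 - 'X]: it keeps the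
    partial sums periodic in the first case and constant in the second. *)
Definition sim_state (g : bool) (ef : bool * bool) (T : nat -> int) : Prop :=
  if g then [/\ ef.2, periodic p T & ~~ ef.1 -> \sum_(i < p) T i = 0]
  else (forall n, (0 < n)%N -> T n = T 1%N) /\ (~~ ef.1 -> T 1%N = 0).

Definition settles (e' : bool) (U : nat -> int) : Prop :=
  (forall n, (p < n)%N -> U n = U p.+1) /\ (~~ e' -> U p.+1 = 0).

(** A window of [p] terms over a sequence constant from index 1, or over a periodic one, is constant
    from index [p] on; this is why [settles] looks past [p]. The case ruled out by [good] is the
    difference of a periodic state, which is periodic only from index 1 on. *)
Lemma sim_letter g e f w T : good g ((e, f) :: w) -> sim_state g (e, f) T ->
  exists U, letter p e (next w).1 f (next w).2 T U /\
    let g' := if f == (next w).2 then g else (next w).2 in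
    if g' then [/\ (next w).2, periodic p U & ~~ (next w).1 -> \sum_(i < p) U i = 0]
    else settles (next w).1 U.
Proof.
rewrite /=; case: (next w) => e' f' /= /andP[gd _].
case: g gd => [gd [/= fT perT sumT]|_ [/= evT T1]].
  rewrite fT in gd *.
  case: f' gd => /= gd.
    case: e e' gd sumT => [] [] //= _ sumT.
    + by exists T; split; [exact: letter00|].
    + by exists (cum T); split; [exact: letterN0|split=> //; apply: periodic_cum; rewrite ?sumT].
    + by exists T; split; [exact: letter00|].
  case: e e' {gd} sumT => [] [] /= sumT.
  + exists (win p T); split; first exact: letter0P.
    by split=> // n pn; rewrite !(win_periodic perT) // ltnW.
  + exists (gap p T); split; first exact: letterPP.
    by split=> [n pn|_]; rewrite !(gap_periodic perT) // ltnW.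
  + exists (win p (cum T)); split; first exact: letterNP.
    have perC : periodic p (cum T) by apply: periodic_cum; rewrite ?sumT.
    by split=> // n pn; rewrite !(win_periodic perC) // ltnW.
  + exists (win p T); split; first exact: letter0P.
    by split=> [n pn|_]; rewrite !(win_periodic perT) ?sumT // ltnW.
have cumE : T 1%N = 0 -> forall n, cum T n = T 0%N.
  move=> T10; elim=> [|n IHn]; first exact: cum0.
  by rewrite cumS IHn (evT n.+1) // T10 addr0.
have sumE m : \sum_(i < p) T (m.+1 + i)%N = p%:Z * T 1%N.
  rewrite (eq_bigr (fun _ => T 1%N)) => [|i _]; last by rewrite evT.
  by rewrite sumr_const card_ord -mulr_natl natz.
have winE n : (p <= n)%N -> win p T n = p%:Z * T 1%N.
  by move=> pn; rewrite /win pn -{1}(subnK pn) cumB sumE.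
case: f f' => [] [].
- case: e e' T1 => [] [] /= T1.
  + exists T; split; first exact: letter00.
    by split=> // n pn; rewrite !evT //; lia.
  + exists (diff T); split; first exact: letterP0.
    by split=> [n pn|_]; rewrite !diff_tail //; lia.
  + exists (cum T); split; first exact: letterN0.
    by split=> // n pn; rewrite !cumE // T1.
  + exists T; split; first exact: letter00.
    by split=> [n pn|_]; rewrite !evT ?T1 //; lia.
- case: e e' T1 => [] [] /= T1.
  + exists (win p T); split; first exact: letter0P.
    by split=> // n pn; rewrite !winE // ltnW.
  + exists (gap p T); split; first exact: letterPP.
    have G n : (p < n)%N -> gap p T n = 0.
      by move=> pn; rewrite /gap ltnW // !(evT (_ - _)%N) ?subn_gt0 // evT ?subrr //; lia.
    by split=> [n pn|_]; rewrite !G.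
  + exists (win p (cum T)); split; first exact: letterNP.
    have perC : periodic p (cum T) by move=> n; rewrite !cumE ?T1.
    by split=> // n pn; rewrite !(win_periodic perC) // ltnW.
  + exists (win p T); split; first exact: letter0P.
    by split=> [n pn|_]; rewrite !winE ?T1 ?mulr0 // ltnW.
(* With at most two differences the result is supported on the indices 0, 1, 2, which fit in one
   period because [p > 2]. *)
- exists (pext p (iter (1 + e - e') diff T)); split; last first.
    split=> //; first exact: periodic_pext.
    move=> e'F; rewrite (eq_bigr (fun i : 'I_p => iter (1 + e - e') diff T i)); last first.
      by move=> i _; rewrite /pext modn_small.
    case: p p_gt2 => // p' p'2; case: e' e T1 e'F => [] [] //= T1 _; rewrite sum_diff.
      by rewrite diff_tail.
    by rewrite evT ?T1 //; lia.
  apply: letter_pext => // n pn; case: e' e T1 => [] [] /= T1.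
  + by rewrite diff_tail //; lia.
  + by rewrite evT ?T1 //; lia.
  + by rewrite /diff; case: n pn => [|[|[|n]]] pn; rewrite ?subrr; (try lia);
      rewrite !evT // !subrr.
  + by rewrite diff_tail //; lia.
case: e e' T1 => [] [] /= T1.
+ exists T; split; first exact: letter00.
  by split=> // n pn; rewrite !evT //; lia.
+ exists (diff T); split; first exact: letterP0.
  by split=> [n pn|_]; rewrite !diff_tail //; lia.
+ exists (cum T); split; first exact: letterN0.
  by split=> // n pn; rewrite !cumE // T1.
+ exists T; split; first exact: letter00.
  by split=> [n pn|_]; rewrite !evT ?T1 //; lia.
Qed.

(** All samples but the first lie past [p], so only [m] matters, and any [m > p] may be replaced by
    [p + 1]. This is a residue below both primes: being odd and larger than the odd [p], they exceed
    [p + 1]. *)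
Lemma sec_settled e' U m : settles e' U -> sec q m U =1 sec r (minn m p.+1) U.
Proof.
move=> [evU _] j; rewrite /sec; case: j => [|j].
  rewrite !muln0 !addn0; case: (leqP m p.+1) => // pm.
  by rewrite !(evU m) // ltnW.
have step k : (p.+1 < k)%N -> forall i, (p < i + k * j.+1)%N by move=> pk i; rewrite mulnS; lia.
by rewrite !(evU (_ + _)%N) ?step.
Qed.

Lemma settled_sim_state e' f' U m : settles e' U -> sim_state false (e', f') (sec q m U).
Proof.
move=> [evU U0].
have big n : (0 < n)%N -> (p < m + q * n)%N by case: n => // n _; rewrite mulnS; lia.
by split=> [n n0|/U0 U0']; rewrite /sec evU ?big // evU // big.
Qed.

(** For [q = r] modulo [p] the samplings agree. For [q = - r], mirroring [i -> U (m + q * i)] gives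
    [i -> U (m - q + r * i)], again a sampling by [r]; [m + p.-1 * q] stands for [m - q]. *)
Lemma sec_periodic_match e w U m : periodic p U -> (~~ e -> \sum_(i < p) U i = 0) ->
  exists2 m', (m' < r)%N & forall n, exists n',
    `|act (wpoly p r 0 ((e, true) :: w)) (sec q m U) n| =
    `|act (wpoly p r 0 ((e, true) :: w)) (sec r m' U) n'|.
Proof.
move=> perU sumU; case: qr => [E|dvd_qr].
  exists (m %% p)%N => [|n]; first by rewrite (ltn_trans _ pr) // ltn_mod.
  exists n; congr `|_|; apply: act_ext => i _; rewrite /sec; apply: periodic_eqmod perU _.
  by rewrite modnDml -modnDmr -modnMml E modnMml modnDmr.
exists ((m + p.-1 * q) %% p)%N => [|n]; first by rewrite (ltn_trans _ pr) // ltn_mod.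
have sumV : ~~ e -> \sum_(i < p) sec q m U i = 0 by move=> /sumU; rewrite sum_sec.
have perV : periodic p (sec q m U) by exact: periodic_sec.
have [n' ->] := act_wpoly_mirror pr_p pr_r p_neq_r w n perV sumV.
exists n'; congr `|_|; apply: act_ext => i _; rewrite /mirror /sec.
apply: periodic_eqmod => //; rewrite modnDml -!addnA; apply/eqP; rewrite eqn_modDl; apply/eqP.
have ip : (i %% p < p)%N by rewrite ltn_mod.
transitivity ((q * (p.-1 - i %% p) + (q + r) * i) %% p)%N.
  have /dvdnP[k kE] : (p %| (q + r) * i)%N by rewrite dvdn_mulr.
  by rewrite kE addnC modnMDl.
rewrite mulnDl addnA [(p.-1 * q)%N]mulnC.
rewrite -modnDml -[in RHS]modnDml; congr ((_ + _) %% _)%N.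
have -> : (q * (p.-1 - i %% p) + q * i = q * (i %/ p) * p + q * p.-1)%N.
  rewrite -mulnDr -mulnA -mulnDr; congr (_ * _)%N; have := divn_eq i p.
  by move: (i %/ p * p)%N (i %% p)%N ip => a b; lia.
by rewrite modnMDl.
Qed.

Lemma simulation w g T : good g w -> sim_state g (next w) T ->
  forall n, exists n', `|act (wpoly p q 0 w) T n| = `|act (wpoly p r 0 w) T n'|.
Proof.
elim: w g T => [|[e f] w IHw] g T; first by move=> _ _ n; exists n.
move=> gw sT n; have [U [L]] := sim_letter gw sT.
have mq : (n %% q < q)%N by rewrite ltn_mod.
rewrite {1}(divn_eq n q) addnC mulnC (act_wpoly_cons _ pr_p pr_q p_neq_q mq L).
have gw' : good (if f == (next w).2 then g else (next w).2) w.
  by move: gw => /=; case: (next w) => e' f' /= /andP[].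
set g' := (if _ then _ else _) in gw' *; case: g' gw' => gw' /=.
  case=> f'T perU sumU; have perV : periodic p (sec q (n %% q) U) by exact: periodic_sec.
  have sV : sim_state true (next w) (sec q (n %% q) U).
    by split=> // /sumU; rewrite sum_sec.
  (* First the prime of the polynomial is changed, with the state still sampled by [q]; then the
     sampling of the state is changed. *)
  have [n1 ->] := IHw _ _ gw' sV (n %/ q)%N.
  case: w {IHw gw gw' sV sT} L f'T sumU => [|[e' [] w]] //= L _ sumU.
  have [m' m'r /(_ n1)[n2 ->]] := sec_periodic_match w (n %% q) perU sumU.
  by exists (m' + r * n2)%N;
    rewrite (act_wpoly_cons (w := (e', true) :: w) _ pr_p pr_r p_neq_r m'r L).
move=> stU; have sV := settled_sim_state (next w).2 (n %% q) stU.
have [|n1 ->] := IHw _ (sec q (n %% q) U) gw' _ (n %/ q)%N; first by case: (next w) sV.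
exists (minn (n %% q) p.+1 + r * n1)%N.
rewrite (act_wpoly_cons _ pr_p pr_r p_neq_r _ L); last by rewrite gtn_min p1_lt_r orbT.
by congr `|_|; apply: act_ext => i _; exact: sec_settled stU i.
Qed.

End Simulation.

(** * Sums of a periodic sequence against a sliding window *)

Lemma sum_normr_le (I : finType) (F G : I -> int) :
  (forall i, `|F i| <= G i) -> `|\sum_i F i| <= \sum_i G i.
Proof. by move=> FG; apply: le_trans (ler_norm_sum _ _ _) _; apply: ler_sum. Qed.

(** Each end of the interval is 0 or a value of [f], so its length is controlled by the values and
    the oscillation of [f] without a factor 2. *)
Lemma hull_exists (f : nat -> int) n : exists lo hi : int,
  [/\ lo <= 0, 0 <= hi, (forall x, (x < n)%N -> lo <= f x <= hi),
      lo = 0 \/ (exists x, f x = lo) & hi = 0 \/ exists x, f x = hi].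
Proof.
elim: n => [|n [lo [hi [lo0 hi0 fP loP hiP]]]].
  by exists 0, 0; split=> //; left.
exists (if f n < lo then f n else lo), (if hi < f n then f n else hi).
split.
- by case: ifP => // /ltW fn; exact: le_trans lo0.
- by case: ifP => // /ltW; exact: le_trans hi0.
- move=> x; rewrite ltnS leq_eqVlt => /orP[/eqP->|xn].
    case: ltP => h1; case: ltP => h2; apply/andP; lia.
  have /andP[l1 l2] := fP x xn.
  by case: ltP => h1; case: ltP => h2; apply/andP; lia.
- by case: ifP => _ //; right; exists n.
by case: ifP => _ //; right; exists n.
Qed.

Section Weights.
Variable p : nat.
Implicit Types (f g : nat -> int) (M L K G w : int).

Lemma weight_sup f g L w : (forall x, (x < p)%N -> `|g x| <= w) ->
  \sum_(x < p) `|f x| <= L -> 0 <= w -> `|\sum_(x < p) g x * f x| <= w * L.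
Proof.
move=> gw fL w0; apply: le_trans (ler_wpM2l w0 fL).
rewrite mulr_sumr; apply: sum_normr_le => x.
by rewrite normrM ler_wpM2r ?gw.
Qed.

(** [|g| + g] is twice the positive part of [g], so [G] bounds the total weight of each sign.
    Positive weights contribute at most [G * hi], negative ones at most [- G * lo], and
    [hi - lo <= M]. *)
Lemma weight_hull f g M G : (forall i, `|f i| <= M) -> (forall i j, f i - f j <= M) ->
  \sum_(x < p) (`|g x| + g x) <= 2 * G -> \sum_(x < p) (`|g x| - g x) <= 2 * G ->
  `|\sum_(x < p) g x * f x| <= G * M.
Proof.
move=> fM fsp gp gn; have [lo [hi [lo0 hi0 fP loP hiP]]] := hull_exists f p.
have hl : hi - lo <= M.
  case: loP hiP => [->|[x <-]] [->|[y <-]] //.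
  - by have := fM 0%N; have := normr_ge0 (f 0%N); lia.
  - by have := fM y; lia.
  - by have := fM x; lia.
have G0 : 0 <= G.
  have : 0 <= \sum_(x < p) (`|g x| + g x) by apply: sumr_ge0 => i _; lia.
  by lia.
have two (h : nat -> int) :
    (forall x, (x < p)%N -> 2 * h x <= (`|g x| + g x) * hi - (`|g x| - g x) * lo) ->
    2 * \sum_(x < p) h x <= 2 * (G * M).
  move=> H; rewrite mulr_sumr.
  apply: le_trans (_ : \sum_(x < p) ((`|g x| + g x) * hi - (`|g x| - g x) * lo) <= _).
    by apply: ler_sum => i _; exact: H.
  rewrite sumrB -!mulr_suml.
  move: (\sum_(x < p) (`|g x| + g x)) (\sum_(x < p) (`|g x| - g x)) gp gn => a b ga gb.
  by clear -ga gb lo0 hi0 hl G0; nia.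
have two' (h : nat -> int) :
    (forall x, (x < p)%N -> 2 * h x <= (`|g x| - g x) * hi - (`|g x| + g x) * lo) ->
    2 * \sum_(x < p) h x <= 2 * (G * M).
  move=> H; rewrite mulr_sumr.
  apply: le_trans (_ : \sum_(x < p) ((`|g x| - g x) * hi - (`|g x| + g x) * lo) <= _).
    by apply: ler_sum => i _; exact: H.
  rewrite sumrB -!mulr_suml.
  move: (\sum_(x < p) (`|g x| + g x)) (\sum_(x < p) (`|g x| - g x)) gp gn => a b ga gb.
  by clear -ga gb lo0 hi0 hl G0; nia.
have A : 2 * \sum_(x < p) g x * f x <= 2 * (G * M).
  apply: (two (fun x => g x * f x)) => x /fP /andP[l1 l2].
  by clear -l1 l2; case: (lerP 0 (g x)) => g0; nia.
have B : 2 * \sum_(x < p) - (g x * f x) <= 2 * (G * M).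
  apply: (two' (fun x => - (g x * f x))) => x /fP /andP[l1 l2].
  by clear -l1 l2; case: (lerP 0 (g x)) => g0; nia.
rewrite sumrN in B; move: (\sum_(x < p) g x * f x) (G * M) A B => a b A B.
by clear -A B; lia.
Qed.

(** Dual to [weight_hull]: here the weights lie in an interval around 0, and [K] bounds the mass of
    each sign of [f]. *)
Lemma weight_parts f g K (al be : int) : 0 <= al -> 0 <= be ->
  (forall x, (x < p)%N -> - be <= g x <= al) ->
  \sum_(x < p) (`|f x| + f x) <= 2 * K -> \sum_(x < p) (`|f x| - f x) <= 2 * K ->
  `|\sum_(x < p) g x * f x| <= (al + be) * K.
Proof.
move=> al0 be0 gP fp fn.
have A : 2 * \sum_(x < p) g x * f x <= 2 * ((al + be) * K).
  rewrite mulr_sumr.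
  apply: le_trans (_ : \sum_(x < p) (al * (`|f x| + f x) + be * (`|f x| - f x)) <= _).
    apply: ler_sum => i _; have /andP[g1 g2] := gP i (ltn_ord i).
    by move: (f i) (g i) g1 g2 => a b; clear -al0 be0 => g1 g2; case: (lerP 0 a) => a0; nia.
  rewrite big_split /= -!mulr_sumr.
  move: (\sum_(x < p) _) (\sum_(x < p) _) fp fn => a b ga gb.
  by clear -ga gb al0 be0; nia.
have B : 2 * \sum_(x < p) - (g x * f x) <= 2 * ((al + be) * K).
  rewrite mulr_sumr.
  apply: le_trans (_ : \sum_(x < p) (be * (`|f x| + f x) + al * (`|f x| - f x)) <= _).
    apply: ler_sum => i _; have /andP[g1 g2] := gP i (ltn_ord i).
    by move: (f i) (g i) g1 g2 => a b; clear -al0 be0 => g1 g2; case: (lerP 0 a) => a0; nia.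
  rewrite big_split /= -!mulr_sumr.
  move: (\sum_(x < p) _) (\sum_(x < p) _) fp fn => a b ga gb.
  by clear -ga gb al0 be0; nia.
rewrite sumrN in B; move: (\sum_(x < p) g x * f x) ((al + be) * K) A B => a b A B.
by clear -A B; lia.
Qed.

End Weights.

Section Windows.
Variable p : nat.
Hypothesis p_gt0 : (0 < p)%N.

Definition arc (g y : nat) : int := (y %% p < g)%N%:Z.

Lemma periodic_arc g : periodic p (arc g).
Proof. by move=> n; rewrite /arc modnDr. Qed.

Lemma sum_arc g m : (g <= p)%N -> \sum_(i < p) arc g (m + i) = g%:Z.
Proof.
move=> gp; rewrite (sum_periodic_shift _ (periodic_arc g)).
rewrite -(big_mkord xpredT (arc g)) (big_cat_nat (n := g)) //=.
rewrite [X in _ + X]big_nat [X in _ + X]big1 ?addr0 => [|i /andP[gi ip]]; last first.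
  by rewrite /arc modn_small // ltnNge gi.
rewrite big_nat (eq_bigr (fun _ => 1)) => [|i /andP[_ ig]].
  by rewrite -big_nat sumr_const_nat subn0 natz.
by rewrite /arc modn_small ?ig // (leq_trans ig).
Qed.

Lemma sum_arc_rev g n : (g <= p)%N -> \sum_(x < p) arc g (n + (p - x)) = g%:Z.
Proof.
move=> gp; rewrite (reindex_inj rev_ord_inj) /= -(sum_arc n.+1 gp).
by apply: eq_bigr => i _; congr arc; have := ltn_ord i; lia.
Qed.

Lemma sum_pick f n a : periodic p f -> (a < p)%N ->
  \sum_(x < p) ((n + (p - x)) %% p == a)%N%:Z * f x = f (n + (p - a))%N.
Proof.
move=> perf ap; pose x0 := Ordinal (ltn_pmod (n + (p - a)) p_gt0).
have modE (x : 'I_p) : ((n + (p - x)) %% p == a)%N = (x == x0).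
  have xp := ltn_ord x.
  rewrite -val_eqE /= -{2}(modn_small xp) -{1}(modn_small ap).
  rewrite -[LHS](eqn_modDr x) -[RHS](eqn_modDr a) -addnA subnK; last exact: ltnW.
  by rewrite -addnA subnK ?[(a + x)%N]addnC 1?[RHS]eq_sym // ltnW.
rewrite (bigD1 x0) // modE eqxx mul1r big1 => [|x /negPf xN].
  by rewrite /= addr0 (periodic_mod _ perf).
by rewrite (modE x) xN mul0r.
Qed.

(* [imp] tells whether the cut of the periodic sequence falls strictly inside
   the window, so that the outgoing value is missing from the first term. *)
Definition window_diff (f : nat -> int) (g : nat) (imp : bool) (T : nat -> int) :=
  T 0%N = f 0%N - (if imp then 0 else f (p - g)%N) /\
  forall n, T n.+1 = f n.+1 - f (n.+1 + (p - g))%N.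

(** Telescoping leaves the last [g] positions up to [n], minus the [g] positions before index 0
    ([g - 1] of them if [imp]), all read modulo [p] with [p - x] for [- x]. *)
Definition weight g (imp : bool) n x : int := arc g (n + (p - x)) - (p - x <= g - imp)%N%:Z.

Lemma cum_window f g (imp : bool) T n : periodic p f -> (0 < g)%N -> (g < p)%N ->
  window_diff f g imp T -> cum T n = \sum_(x < p) weight g imp n x * f x.
Proof.
move=> perf g0 gp [T0 TS]; elim: n => [|n IHn].
  rewrite cum0 T0; have := sum_pick 0 perf p_gt0.
  have := sum_pick 0 perf gp; rewrite !add0n subn0 -[in f p](add0n p) perf => <- <-.
  case: imp {T0}; last rewrite -sumrB; rewrite ?subr0; apply: eq_bigr => x _; rewrite -?mulrBl;
    congr (_ * _); rewrite /weight /arc add0n; have xp := ltn_ord x;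
    (have [x0|x0] := posnP x; [rewrite x0 subn0 modnn | rewrite modn_small ?ltn_subrL ?x0 //]); lia.
rewrite cumS TS IHn; have := sum_pick n.+1 perf p_gt0.
rewrite subn0 perf => <-; rewrite -(sum_pick n.+1 perf gp) -sumrB -big_split /=.
apply: eq_bigr => x _; rewrite -mulrBl -mulrDl; congr (_ * _).
rewrite /weight addrAC; congr (_ - _); rewrite /arc addSn.
move: (n + (p - x))%N => y.
have [[a b]|[a b]] :
    ((y.+1 %% p = (y %% p).+1 /\ (y %% p).+1 < p) \/ (y.+1 %% p = 0 /\ (y %% p).+1 = p))%N.
  have := ltn_pmod y p_gt0; rewrite leq_eqVlt => /orP[/eqP E|lt_p].
    by right; rewrite -addn1 -modnDml addn1 E modnn.
  by left; rewrite -addn1 -modnDml addn1 modn_small.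
- by rewrite a; lia.
by rewrite a; lia.
Qed.

(** For fixed [x] the weights never change sign, and over a full period of [n] they add up to
    [- (p - g)] or [g]; a partial range stays in between. *)
Lemma weight_range g (imp : bool) n1 n2 x : (0 < g)%N -> (g < p)%N -> (x < p)%N ->
  (n1 <= n2)%N -> (n2 <= p)%N ->
  if (p - x <= g - imp)%N then - (p - g)%:Z <= \sum_(n1 <= n < n2) weight g imp n x <= 0
  else 0 <= \sum_(n1 <= n < n2) weight g imp n x <= g%:Z.
Proof.
move=> g0 gp xp n12 n2p.
have cnt : \sum_(0 <= n < p) arc g (n + (p - x)) = g%:Z.
  rewrite big_mkord -(sum_arc (p - x) (ltnW gp)).
  by apply: eq_bigr => i _; rewrite addnC.
have split3 (F : nat -> int) : \sum_(0 <= n < p) F n =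
    \sum_(0 <= n < n1) F n + \sum_(n1 <= n < n2) F n + \sum_(n2 <= n < p) F n.
  by rewrite -!big_cat_nat // (leq_trans n12).
have arc01 y : 0 <= arc g y <= 1 by rewrite /arc; case: (_ < _)%N.
have ge0 (F : nat -> int) a b : (forall n, 0 <= F n) -> 0 <= \sum_(a <= n < b) F n.
  by move=> F0; apply: sumr_ge0 => i _.
case: ifP => W; rewrite /weight W.
  have cnt' : \sum_(0 <= n < p) (1 - arc g (n + (p - x))) = (p - g)%:Z.
    by rewrite sumrB cnt sumr_const_nat subn0 natz; lia.
  have pos n : 0 <= 1 - arc g (n + (p - x)) by have := arc01 (n + (p - x))%N; lia.
  have -> : \sum_(n1 <= n < n2) (arc g (n + (p - x)) - 1%N%:Z) =
      - \sum_(n1 <= n < n2) (1 - arc g (n + (p - x))).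
    by rewrite -sumrN; apply: eq_bigr => i _; rewrite opprB.
  move: cnt'; rewrite split3.
  have := ge0 _ 0%N n1 pos; have := ge0 _ n1 n2 pos; have := ge0 _ n2 p pos.
  by move: (\sum_(0 <= n < n1) _) (\sum_(n1 <= n < n2) _) (\sum_(n2 <= n < p) _) => a b c; lia.
have pos n : 0 <= arc g (n + (p - x)) by have /andP[] := arc01 (n + (p - x))%N.
have -> : \sum_(n1 <= n < n2) (arc g (n + (p - x)) - 0%N%:Z) =
    \sum_(n1 <= n < n2) arc g (n + (p - x)).
  by apply: eq_bigr => i _; rewrite subr0.
move: cnt; rewrite split3.
have := ge0 _ 0%N n1 pos; have := ge0 _ n1 n2 pos; have := ge0 _ n2 p pos.
by move: (\sum_(0 <= n < n1) _) (\sum_(n1 <= n < n2) _) (\sum_(n2 <= n < p) _) => a b c; lia.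
Qed.

End Windows.

Lemma leq_sqr_mean a b m : (a + b <= m.*2)%N -> (a * b <= m * m)%N.
Proof.
move=> abm; rewrite -(@leq_pmul2l 4) //; apply: leq_trans (nat_AGM2 a b) _.
by rewrite (_ : 4 * (m * m) = m.*2 ^ 2)%N ?leq_sqr // -mul2n expnMn mulnn.
Qed.

(** Using one [M] for values and oscillation says that 0 and all values lie in a common interval of
    length [M]. *)
Definition bounded p (M L : int) (f : nat -> int) :=
  [/\ periodic p f, (forall i, `|f i| <= M), (forall i j, f i - f j <= M)
    & \sum_(x < p) `|f x| <= L].

Section WindowBounds.
Variables (p mu g : nat) (imp : bool) (f T : nat -> int) (M L K : int).
Hypotheses (p_gt0 : (0 < p)%N) (p_mu : (p < mu.*2)%N) (g_gt0 : (0 < g)%N) (gp : (g < p)%N).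
Hypotheses (fP : bounded p M L f) (fT : window_diff p f g imp T).
Hypothesis fK : \sum_(x < p) (`|f x| + f x) <= 2 * K.
Hypothesis fK' : \sum_(x < p) (`|f x| - f x) <= 2 * K.

Let perf : periodic p f. Proof. by case: fP. Qed.
Let fM i : `|f i| <= M. Proof. by case: fP. Qed.
Let fsp i j : f i - f j <= M. Proof. by case: fP. Qed.
Let fL : \sum_(x < p) `|f x| <= L. Proof. by case: fP. Qed.
Let arc01 c y : 0 <= arc p c y <= 1. Proof. by rewrite /arc; case: (_ < _)%N. Qed.

Let inside x : int := (p - x <= g - imp)%N%:Z.
Let inside01 x : 0 <= inside x <= 1. Proof. by rewrite /inside; case: (_ <= _)%N. Qed.

Let sum_inside : \sum_(x < p) inside x = (g - imp)%N%:Z.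
Proof.
have gip : (g - imp <= p)%N by rewrite (leq_trans (leq_subr _ _)) // ltnW.
rewrite -(sum_arc 0 gip) (reindex_inj rev_ord_inj) /=.
apply: eq_bigr => i _; have ip := ltn_ord i.
by rewrite /inside /arc add0n modn_small // subKn.
Qed.

Let sum_arcs n : \sum_(x < p) arc p g (n + (p - x)) = g%:Z.
Proof. exact/sum_arc_rev/ltnW. Qed.

Let sum1 : \sum_(x < p) 1 = p%:Z :> int.
Proof. by rewrite sumr_const card_ord natz. Qed.

Lemma cum_window_sup n : `|cum T n| <= L.
Proof.
rewrite (cum_window p_gt0 _ perf g_gt0 gp fT) -[L]mul1r; apply: weight_sup => // x _.
by have := arc01 g (n + (p - x)); have := inside01 x; rewrite /weight -/(inside x); lia.
Qed.

(** If [g <= mu], weights of each sign occur at most [g] times. Otherwise complements are counted,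
    and [p - g + 1 <= mu] since [p < 2 * mu]. *)
Lemma cum_window_hull n : `|cum T n| <= mu%:Z * M.
Proof.
rewrite (cum_window p_gt0 _ perf g_gt0 gp fT); apply: weight_hull => //.
  have [le_mu|gt_mu] := leqP g mu.
    apply: le_trans (_ : \sum_(x < p) 2 * arc p g (n + (p - x)) <= _); last first.
      by rewrite -mulr_sumr sum_arcs; lia.
    apply: ler_sum => x _; have := arc01 g (n + (p - x)); have := inside01 x.
    by rewrite /weight -/(inside x); lia.
  apply: le_trans (_ : \sum_(x < p) 2 * (1 - inside x) <= _); last first.
    rewrite -mulr_sumr sumrB sum1 sum_inside; move: p_mu gt_mu gp; clear; lia.
  apply: ler_sum => x _; have := arc01 g (n + (p - x)); have := inside01 x.
  by rewrite /weight -/(inside x); lia.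
have [le_mu|gt_mu] := leqP g mu.
  apply: le_trans (_ : \sum_(x < p) 2 * inside x <= _); last first.
    by rewrite -mulr_sumr sum_inside; lia.
  apply: ler_sum => x _; have := arc01 g (n + (p - x)); have := inside01 x.
  by rewrite /weight -/(inside x); lia.
apply: le_trans (_ : \sum_(x < p) 2 * (1 - arc p g (n + (p - x))) <= _); last first.
  rewrite -mulr_sumr sumrB sum1 sum_arcs; move: p_mu gt_mu gp; clear; lia.
apply: ler_sum => x _; have := arc01 g (n + (p - x)); have := inside01 x.
by rewrite /weight -/(inside x); lia.
Qed.

Let cumBE n n' : cum T n - cum T n' =
  \sum_(x < p) (arc p g (n + (p - x)) - arc p g (n' + (p - x))) * f x.
Proof.
rewrite !(cum_window p_gt0 _ perf g_gt0 gp fT) -sumrB; apply: eq_bigr => x _.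
by rewrite -mulrBl /weight; congr (_ * _); lia.
Qed.

Lemma cumB_window_sup n n' : cum T n - cum T n' <= L.
Proof.
apply: le_trans (ler_norm _) _.
rewrite cumBE -[L]mul1r.
apply: (weight_sup (g := fun x => arc p g (n + (p - x)) - arc p g (n' + (p - x)))) => // x _.
by have := arc01 g (n + (p - x)); have := arc01 g (n' + (p - x)); lia.
Qed.

Lemma cumB_window_hull n n' : cum T n - cum T n' <= mu%:Z * M.
Proof.
apply: le_trans (ler_norm _) _; rewrite cumBE.
apply: (weight_hull (g := fun x => arc p g (n + (p - x)) - arc p g (n' + (p - x)))) => //;
  (have [le_mu|gt_mu] := leqP g mu).
- apply: le_trans (_ : \sum_(x < p) 2 * arc p g (n + (p - x)) <= _); last first.
    by rewrite -mulr_sumr sum_arcs; lia.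
  by apply: ler_sum => x _; have := arc01 g (n + (p - x)); have := arc01 g (n' + (p - x)); lia.
- apply: le_trans (_ : \sum_(x < p) 2 * (1 - arc p g (n' + (p - x))) <= _); last first.
    rewrite -mulr_sumr sumrB sum1 sum_arcs; move: p_mu gt_mu gp; clear; lia.
  by apply: ler_sum => x _; have := arc01 g (n + (p - x)); have := arc01 g (n' + (p - x)); lia.
- apply: le_trans (_ : \sum_(x < p) 2 * arc p g (n' + (p - x)) <= _); last first.
    by rewrite -mulr_sumr sum_arcs; lia.
  by apply: ler_sum => x _; have := arc01 g (n + (p - x)); have := arc01 g (n' + (p - x)); lia.
apply: le_trans (_ : \sum_(x < p) 2 * (1 - arc p g (n + (p - x))) <= _); last first.
  rewrite -mulr_sumr sumrB sum1 sum_arcs; move: p_mu gt_mu gp; clear; lia.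
by apply: ler_sum => x _; have := arc01 g (n + (p - x)); have := arc01 g (n' + (p - x)); lia.
Qed.

Section Range.
Variables n1 n2 : nat.
Hypotheses (n12 : (n1 <= n2)%N) (n2p : (n2 <= p)%N).

Let wt x := \sum_(n1 <= n < n2) weight p g imp n x.

Let rangeE : \sum_(n1 <= n < n2) cum T n = \sum_(x < p) wt x * f x.
Proof.
rewrite (eq_bigr (fun n => \sum_(x < p) weight p g imp n x * f x)) => [|n _].
  by rewrite exchange_big; apply: eq_bigr => x _; rewrite mulr_suml.
exact: cum_window.
Qed.

Let wtP x : (x < p)%N ->
  - ((p - g)%N%:Z * inside x) <= wt x <= g%:Z * (1 - inside x).
Proof.
move=> xp; have := weight_range p_gt0 imp g_gt0 gp xp n12 n2p.
by rewrite -/(wt x) /inside; case: (_ <= _)%N => /andP[a b];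
  rewrite /= ?subrr ?subr0 ?mulr0 ?mulr1 ?oppr0 ?a ?b.
Qed.

Lemma range_window_parts : `|\sum_(n1 <= n < n2) cum T n| <= p%:Z * K.
Proof.
rewrite rangeE; have -> : p%:Z = g%:Z + (p - g)%N%:Z by move: gp; clear; lia.
apply: weight_parts => // x xp; have /andP[a b] := wtP xp; have /andP[c d] := inside01 x.
apply/andP; split; [apply: le_trans a | apply: le_trans b _].
  by move: (inside x) (p - g)%N c d => u k; clear; nia.
by move: (inside x) c d => u; clear; nia.
Qed.

Lemma range_window_sup : (g <= mu)%N -> (p - g <= mu)%N ->
  `|\sum_(n1 <= n < n2) cum T n| <= mu%:Z * L.
Proof.
move=> gmu pgmu; rewrite rangeE; apply: weight_sup => // x xp.
have /andP[a b] := wtP xp; have /andP[c d] := inside01 x.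
have a' : - mu%:Z <= wt x.
  by apply: le_trans a; move: (inside x) (p - g)%N c d pgmu => u k; clear; nia.
have b' : wt x <= mu%:Z by apply: le_trans b _; move: (inside x) c d gmu => u; clear; nia.
by move: a' b'; clear; lia.
Qed.

(** Positive weights are at most [g], at [p - (g - imp)] places; negative ones at most [p - g] in
    size, at [g - imp] places. In both products the factors add up to at most [p + 1 <= 2 * mu], so
    each product is at most [mu * mu]. *)
Lemma range_window_hull : `|\sum_(n1 <= n < n2) cum T n| <= mu%:Z * mu%:Z * M.
Proof.
rewrite rangeE.
have b1 : (g * (p - (g - imp)) <= mu * mu)%N.
  by apply: leq_sqr_mean; move: p_mu gp g_gt0; clear; lia.
have b2 : ((p - g) * (g - imp) <= mu * mu)%N.
  by apply: leq_sqr_mean; move: p_mu gp g_gt0; clear; lia.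
apply: weight_hull => //.
  apply: le_trans (_ : \sum_(x < p) 2 * (g%:Z * (1 - inside x)) <= _); last first.
    by rewrite -!mulr_sumr sumrB sum1 sum_inside; move: b1 gp g_gt0; clear; nia.
  apply: ler_sum => x _; have /andP[a b] := wtP (ltn_ord x); have := inside01 x.
  have : wt x <= 0 \/ 0 <= wt x by lia.
  move: (wt x) (inside x) a b => u v; clear; nia.
apply: le_trans (_ : \sum_(x < p) 2 * ((p - g)%N%:Z * inside x) <= _); last first.
  by rewrite -!mulr_sumr sum_inside; move: b2; clear; nia.
apply: ler_sum => x _; have /andP[a b] := wtP (ltn_ord x); have := inside01 x.
have : wt x <= 0 \/ 0 <= wt x by lia.
move: (wt x) (inside x) a b => u v; clear; nia.
Qed.
End Range.

End WindowBounds.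

(** * Norm bounds for the remaining words *)

(* [(c, i, m)] stands for [c * p ^ i * mu ^ m]. *)
Definition monomial := (nat * nat * nat)%type.
Definition mulp (x : monomial) : monomial := let: (c, i, m) := x in (c, i.+1, m).
Definition mulmu (x : monomial) : monomial := let: (c, i, m) := x in (c, i, m.+1).
Definition mul2 (x : monomial) : monomial := let: (c, i, m) := x in (c.*2, i, m).

(** Shapes of a state, with bounds: [SC] a single term at index 0, [SO] constant from index 1, [SM]
    the same with a monotone jump of constant sign, [SV] periodic, [SZ] periodic with zero sum, [SD]
    difference of a periodic sequence and its shift. Their meaning is fixed by [sem]. *)
Inductive astate :=
| SC of monomial
| SO of monomial
| SM of monomial
| SV of monomial & monomial
| SZ of monomial & monomial & monomial
| SD of monomial & monomial & monomial & bool.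

(* Each list offers alternative bounds for the next state, none if it is empty.
   The flag of [SD] holds while the window still has length [s] or [p - s]. *)
Definition step (st : astate) (e e' f f' : bool) : seq astate :=
  match st with
  | SC M =>
      if f == f' then (if e == e' then [:: SC M] else if e then [:: SC M] else [:: SO M])
      else if f then
        (if e == e' then [:: SC M] else if e then [:: SC M] else [:: SM (mulp M)])
      else if e == e' then [:: SZ M (mulmu M) (mulp M)]
      else if e then [:: SZ (mul2 M) (mulp M) (mulp M)] else [:: SV M M]
  | SO M =>
      if f == f' then (if e == e' then [:: SO M] else if e then [:: SC M] else [::])
      else if f then
        (if e == e' then [:: SO (mulp M)] else if e then [:: SC M] else [::])
      else if e == e' then [:: SV (mul2 M) (mul2 M)]
      else if e then [:: SZ (mul2 M) (mulp M) (mulp M)] else [::]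
  | SM M =>
      if f == f' then (if e == e' then [:: SM M] else if e then [:: SC M] else [::])
      else if f then
        (if e == e' then [:: SO (mulp M)] else if e then [:: SC M] else [::])
      else if e == e' then [:: SV M M]
      else if e then [:: SZ M (mulmu M) (mulp M)] else [::]
  | SV M L =>
      if f == f' then
        (if e == e' then [:: SV M L] else if e then [:: SD M L L true] else [::])
      else if f then (if e == e' then [:: SO L] else if e then [:: SC M] else [::])
      else [::]
  | SZ N D D' =>
      if f == f' then
        (if e == e' then [:: SZ N D' D']
         else if e then [:: SD (mul2 N) (mul2 N) N true] else [:: SV N D])
      else if f then (if (e == e') || e then [:: SC N] else [:: SO D])
      else [::]
  | SD M L K now =>
      if f == f' then
        (if e == e' then [:: SD M L K false] else if e then [::]
         else [:: SV (mulmu M) (mulp (mulmu M)); SV L (mulp L)])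
      else if f then
        (if e == e' then [:: SC (mulmu M); SC L] else if e then [::]
         else [:: SO (mulmu (mulmu M)), SO (mulp K) & if now then [:: SO (mulmu L)] else [::]])
      else [::]
  end.

(* Sound for [c * p ^ i * mu ^ m <= p * mu ^ t] when [2 <= mu < p <= mu ^ 2]. *)
Definition below (t : nat) (x : monomial) : bool :=
  let: (c, i, m) := x in
  if i is i'.+1 then (m + i'.*2 <= t)%N && (c <= 2 ^ (t - (m + i'.*2)))%N
  else (m <= t.+1)%N && (c <= 2 ^ (t.+1 - m))%N.

Fixpoint check (t : nat) (w : seq (bool * bool)) (st : astate) : bool :=
  if w is (e, f) :: w' then
    has (check t w') (step st e (next w').1 f (next w').2)
  else match st with SC M | SO M | SM M => below t M | _ => false end.

Fixpoint all_words (n : nat) (P : seq (bool * bool) -> bool) : bool :=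
  if n is n'.+1 then
    all_words n' (fun w => [&& P ((false, false) :: w), P ((false, true) :: w),
      P ((true, false) :: w) & P ((true, true) :: w)])
  else P [::].

Lemma all_wordsP n P w : all_words n P -> size w = n -> P w.
Proof.
elim: n P w => [|n IHn] P [|[e f] w] //= allP [sz].
by have /and4P[] := IHn _ w allP sz; case: e f => [] [].
Qed.

(** An exhaustive computation: every word either is good or has some chain of bounds ending below
    [p * mu ^ (b.-1)./2]. *)
Lemma words_checked b : (0 < b)%N -> (b <= 5)%N ->
  all_words b.+1 (fun w => good false w || check (b.-1)./2 w (SC (1, 0, 0))).
Proof. by case: b => [|[|[|[|[|[|b]]]]]] // _ _; vm_compute. Qed.

Lemma has_in (T : Type) (P : T -> bool) (l : seq T) : has P l -> exists2 x, List.In x l & P x.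
Proof.
elim: l => //= y l IHl /orP[Py|/IHl[x xl Px]]; first by exists y => //; left.
by exists x => //; right.
Qed.

Definition bC (M : int) (T : nat -> int) :=
  (forall n, (0 < n)%N -> T n = 0) /\ `|T 0%N| <= M.

Definition bO (M : int) (T : nat -> int) := (forall n, (0 < n)%N -> T n = T 1%N) /\
  [/\ `|T 0%N| <= M, `|T 1%N| <= M & `|T 1%N - T 0%N| <= M].

(** Monotonicity gives [|T 0| + |T 1 - T 0| <= M], where [bO] would only give [2 * M]. *)
Definition bM (M : int) (T : nat -> int) := (forall n, (0 < n)%N -> T n = T 1%N) /\
  exists u : bool, [/\ 0 <= (-1) ^+ u * T 0%N, (-1) ^+ u * T 0%N <= (-1) ^+ u * T 1%N
    & (-1) ^+ u * T 1%N <= M].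

(** Zero sum makes the two signs balance, so each has mass at most [N]. [D] concerns the sequence as
    it stands, whose sampling step [q] keeps pulses at most [mu] apart; [D'] survives arbitrary
    resampling. *)
Definition bZ p (N D D' : int) (T : nat -> int) :=
  [/\ periodic p T, \sum_(i < p) T i = 0, \sum_(i < p) `|T i| <= 2 * N,
      \sum_(i < p) `|cum T i| <= D
    & forall m u, coprime u p -> \sum_(i < p) `|cum (sec u m T) i| <= D'].

Definition bD p mu (M L K : int) (now : bool) (T : nat -> int) := exists f g imp,
  [/\ bounded p M L f, \sum_(x < p) (`|f x| + f x) <= 2 * K,
      \sum_(x < p) (`|f x| - f x) <= 2 * K, (0 < g)%N && (g < p)%N
    & window_diff p f g imp T] /\ (now -> (g <= mu)%N /\ (p - g <= mu)%N).

Lemma bM_bO M T : bM M T -> bO M T.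
Proof.
move=> [evT [u [a b c]]]; split=> //.
by split; case: u a b c; rewrite ?mul1r ?mulN1r; lia.
Qed.

Lemma bC_bO M T : bC M T -> bO M T.
Proof.
move=> [T0 TM]; split=> [n n0|]; first by rewrite !T0.
by rewrite (T0 1%N) //; split=> //; have := normr_ge0 (T 0%N); lia.
Qed.

Lemma wrap_dist p v a b : (v < p)%N -> (b = a + v \/ b + p = a + v)%N ->
  `|a%:Z - b%:Z| = v%:Z \/ `|a%:Z - b%:Z| = (p - v)%N%:Z.
Proof. by move=> vp [ab|ab]; [left | right]; lia. Qed.

(** No wrap gives [2 * v = c - a < p], two wraps give [2 * (p - v) = a - c < p], exactly one gives
    [v + (p - v)]. *)
Lemma wrap_dist2 p v a b c : (a < p)%N -> (c < p)%N -> (v < p)%N ->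
  (b = a + v \/ b + p = a + v)%N -> (c = b + v \/ c + p = b + v)%N ->
  `|a%:Z - b%:Z| + `|b%:Z - c%:Z| <= p%:Z.
Proof. by move=> ap cp vp [ab|ab] [bc|bc]; lia. Qed.

Section Transitions.
Variables p q s mu : nat.
Hypotheses (pr_p : prime p) (pr_q : prime q).
Hypotheses (p_gt2 : (2 < p)%N) (pq : (p.+1 < q)%N) (cqp : coprime q p).
Hypotheses (s_gt0 : (0 < s)%N) (sp : (s < p)%N) (qs : q * s = 1 %[mod p]).
Hypotheses (p_mu : (p < mu.*2)%N) (s_mu : (s <= mu)%N) (ps_mu : (p - s <= mu)%N).

Let p_gt0 : (0 < p)%N. Proof. exact: ltn_trans p_gt2. Qed.
Let p_gt1 : (1 < p)%N. Proof. exact: ltn_trans p_gt2. Qed.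

Let sec0 m U : sec q m U 0%N = U m. Proof. by rewrite /sec muln0 addn0. Qed.

Let sec_far m U c : (forall n, (p < n)%N -> U n = c) ->
  forall n, (0 < n)%N -> sec q m U n = c.
Proof. by move=> Uc [|n] // _; rewrite /sec Uc // mulnS; lia. Qed.

(** * Norm bounds under sampling *)

Lemma bC_sec M T m : bC M T -> bC M (sec q m T).
Proof.
move=> [T0 TM]; split=> [n n0|]; last rewrite sec0.
  by rewrite /sec T0 //; case: n n0 => // n _; rewrite mulnS; lia.
by case: m => [|m] //; rewrite T0 //; have := normr_ge0 (T 0%N); lia.
Qed.

Lemma bO_sec M T m : bO M T -> bO M (sec q m T).
Proof.
move=> [evT [a b c]]; have S := sec_far m (c := T 1%N) (fun n pn => evT n (ltn_trans p_gt0 pn)).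
split=> [n n0|]; first by rewrite !S.
rewrite (S 1%N) // sec0; case: m {S} => [|m]; first by split.
by rewrite evT //; split=> //; rewrite subrr; have := normr_ge0 (T 1%N); lia.
Qed.

Lemma bM_sec M T m : bM M T -> bM M (sec q m T).
Proof.
move=> [evT [u [a b c]]]; have S := sec_far m (c := T 1%N) (fun n pn => evT n (ltn_trans p_gt0 pn)).
split=> [n n0|]; first by rewrite !S.
exists u; rewrite (S 1%N) // sec0; case: m {S} => [|m]; first by split.
by rewrite evT //; split=> //; apply: le_trans a b.
Qed.

Lemma bounded_sec M L T m u : coprime u p -> bounded p M L T -> bounded p M L (sec u m T).
Proof.
move=> cup [perT TM Tsp TL]; split; [exact: periodic_sec | by move=> i; apply: TM
  | by move=> i j; apply: Tsp |].
have perN : periodic p (fun i => `|T i|) by move=> i; rewrite perT.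
by rewrite (sum_periodic_affine p_gt0 m cup perN).
Qed.

Lemma sec_sec u m u' m' T : sec u m (sec u' m' T) =1 sec (u' * u) (m' + u' * m) T.
Proof. by move=> j; rewrite /sec; congr T; rewrite mulnDr mulnA addnA. Qed.

Lemma eq_cum T U : T =1 U -> cum T =1 cum U.
Proof. by move=> TU n; apply: eq_bigr => i _; rewrite TU. Qed.

Lemma bZ_sec N D D' T m : bZ p N D D' T -> bZ p N D' D' (sec q m T).
Proof.
move=> [perT sT aT _ DT]; split; [exact: periodic_sec
  | by rewrite (sum_sec p_gt0 m cqp perT) | | exact: DT |].
  have perN : periodic p (fun i => `|T i|) by move=> i; rewrite perT.
  by rewrite (sum_periodic_affine p_gt0 m cqp perN).
move=> m' u cup; rewrite (eq_bigr (fun i : 'I_p => `|cum (sec (q * u) (m + q * m') T) i|)).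
  by apply: DT; rewrite coprimeMl cqp.
by move=> i _; rewrite (eq_cum (@sec_sec _ _ _ _ _)).
Qed.

(** In steps of [q], a shift by [g] becomes a shift by [s * g] modulo [p]. This new length need not
    respect [mu], so the flag is dropped. *)
Lemma bD_sec M L K now T m : bD p mu M L K now T -> bD p mu M L K false (sec q m T).
Proof.
move=> [f [g [imp [[fP fK fK' /andP[g0 gp] [T0 TS]] _]]]].
have [perf _ _ _] := fP.
pose g' := (s * g %% p)%N.
have g'0 : (0 < g')%N.
  rewrite lt0n; apply/negP => /eqP E.
  have : (p %| q * (s * g))%N by rewrite dvdn_mull //; apply/eqP.
  rewrite mulnA /dvdn -modnMml qs modnMml mul1n modn_small //.
  by rewrite (gtn_eqF g0).
have g'p : (g' < p)%N by rewrite ltn_mod.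
have qg' : q * g' = g %[mod p] by rewrite modnMmr mulnA -modnMml qs modnMml mul1n.
have step n : f (n + q * (p - g'))%N = f (n + (p - g))%N.
  apply: periodic_eqmod perf _; apply/eqP.
  rewrite eqn_modDl -(eqn_modDr (q * g' + g)).
  have -> : (q * (p - g') + (q * g' + g) = q * p + g)%N.
    by rewrite addnA -mulnDr subnK // ltnW.
  have -> : (p - g + (q * g' + g) = 1 * p + q * g')%N by move: gp; clear; lia.
  by rewrite !modnMDl qg'.
(* Only a sample starting at [m = 0] sees the possibly incomplete first term. *)
exists (sec q m f), g', (if m is 0%N then imp else false); split=> //.
have [perf' f'M f'sp f'L] := bounded_sec m cqp fP.
have perP : periodic p (fun i => `|f i| + f i) by move=> i; rewrite perf.
have perN : periodic p (fun i => `|f i| - f i) by move=> i; rewrite perf.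
split=> //.
- by rewrite (sum_periodic_affine p_gt0 m cqp perP).
- by rewrite (sum_periodic_affine p_gt0 m cqp perN).
- by rewrite g'0.
split=> [|n]; last first.
  rewrite /sec; have -> : (m + q * n.+1 = (m + q * n.+1).-1.+1)%N.
    by rewrite prednK // mulnS; move: pq; clear; lia.
  rewrite TS prednK; last by rewrite mulnS; move: pq; clear; lia.
  by rewrite mulnDr addnA step.
rewrite sec0 /sec muln0 addn0; case: m {perf' f'M f'sp f'L} => [|m].
  by rewrite T0; case: imp {T0} => //; have := step 0%N; rewrite !add0n => ->.
by rewrite TS step.
Qed.

Lemma cum_nat T n : cum T n = \sum_(0 <= i < n.+1) T i.
Proof. by rewrite big_mkord. Qed.

(** Before index [p] the window is a partial sum from 0, later it is a full period, and their
    difference is a sum over the rest of the period: all three are range sums. *)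
Lemma bO_win B S m : periodic p S ->
  (forall n1 n2, (n1 <= n2)%N -> (n2 <= p)%N -> `|\sum_(n1 <= i < n2) S i| <= B) ->
  bO B (sec q m (win p S)).
Proof.
move=> perS rangeS; have tot n : (p <= n)%N -> win p S n = \sum_(0 <= i < p) S i.
  by move=> pn; rewrite win_periodic // big_mkord.
have far := sec_far m (fun n pn => tot n (ltnW pn)).
split=> [n n0|]; first by rewrite !far.
rewrite (far 1%N) // sec0; have totB := rangeS _ _ (leq0n p) (leqnn p).
have [pm|mp] := leqP p m.
  by rewrite tot //; split=> //; rewrite subrr; have := normr_ge0 (\sum_(0 <= i < p) S i); lia.
rewrite /win leqNgt mp subr0 cum_nat; split=> //; first exact: rangeS.
by rewrite (big_cat_nat (n := m.+1)) //= addrAC subrr add0r; apply: rangeS.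
Qed.

Lemma bC_diff M T m : bO M T -> bC M (sec q m (diff T)).
Proof.
move=> [evT [a b c]]; split=> [n n0|].
  by apply: (sec_far m (c := 0)) => // k pk; rewrite diff_tail // (leq_trans _ pk).
rewrite sec0; case: m => [|[|m]]; first by rewrite /diff subr0.
  exact: c.
by rewrite diff_tail //; have := normr_ge0 (T 0%N); lia.
Qed.

Lemma cum_bC M T : bC M T -> forall n, cum T n = T 0%N.
Proof.
move=> [T0 _]; elim=> [|n IHn]; first exact: cum0.
by rewrite cumS IHn (T0 n.+1) ?addr0.
Qed.

Lemma bO_cum M T m : bC M T -> bO M (sec q m (cum T)).
Proof.
move=> TC; have [_ TM] := TC; split=> [n _|]; rewrite /sec !(cum_bC TC) //.
by split=> //; rewrite subrr; have := normr_ge0 (T 0%N); lia.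
Qed.

Lemma bC_gap M T m : bO M T -> bC M (sec q m (gap p T)).
Proof.
move=> [evT [a b c]]; split=> [n n0|].
  apply: (sec_far m (c := 0)) => // k pk.
  by rewrite /gap ltnW // (evT (_ - _)%N) ?subn_gt0 // evT ?subrr // (leq_trans _ pk).
rewrite sec0 /gap; case: leqP => [pm|mp]; last first.
  by rewrite subr0; case: m mp => [|m] _ //; rewrite evT.
have [<-|pNm] := eqVneq p m; first by rewrite subnn evT.
have pm' : (p < m)%N by rewrite ltn_neqAle pNm.
rewrite (evT (_ - _)%N) ?subn_gt0 // (evT m) ?subrr //; last exact: leq_trans pm'.
by have := normr_ge0 (T 0%N); lia.
Qed.

Lemma bC_win M T m : bC M T -> bC M (sec q m (win p T)).
Proof.
move=> TC; have [_ TM] := TC; split=> [n n0|].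
  by apply: (sec_far m (c := 0)) => // k pk; rewrite /win ltnW // !(cum_bC TC) subrr.
rewrite sec0 /win !(cum_bC TC); case: leqP => _; rewrite ?subr0 // subrr.
by have := normr_ge0 (T 0%N); lia.
Qed.

Lemma cum_settled T n : (forall n, (0 < n)%N -> T n = T 1%N) ->
  cum T n = T 0%N + n%:Z * T 1%N.
Proof.
move=> evT; elim: n => [|n IHn]; first by rewrite cum0 mul0r addr0.
by rewrite cumS IHn (evT n.+1) // intS; ring.
Qed.

Lemma win_settled T n : (forall n, (0 < n)%N -> T n = T 1%N) ->
  win p T n = if (p <= n)%N then p%:Z * T 1%N else T 0%N + n%:Z * T 1%N.
Proof.
move=> evT; rewrite /win !cum_settled //; case: leqP => pn; last by rewrite subr0.
by rewrite -{1}(subnK pn) PoszD; ring.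
Qed.

Lemma bO_win_settled M T m : bO M T -> bO (p%:Z * M) (sec q m (win p T)).
Proof.
move=> [evT [a b c]].
have tot n : (p < n)%N -> win p T n = p%:Z * T 1%N.
  by move=> pn; rewrite win_settled // ltnW.
have far := sec_far m tot; split=> [n n0|]; first by rewrite !far.
have M0 : 0 <= M by apply: le_trans (normr_ge0 _) a.
have tB : `|p%:Z * T 1%N| <= p%:Z * M by rewrite normrM ler_wpM2l.
rewrite (far 1%N) // sec0 win_settled //; case: leqP => [pm|mp].
  by rewrite subrr normr0 mulr_ge0.
have m0 : (m%:Z + 1) <= p%:Z by lia.
split=> //.
  apply: le_trans (_ : (1 + m%:Z) * M <= _); last by rewrite ler_wpM2r // addrC.
  rewrite [leRHS]mulrDl mul1r (le_trans (ler_normD _ _)) // lerD // normrM ler_wpM2l //.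
have -> : p%:Z * T 1%N - (T 0%N + m%:Z * T 1%N) =
    (T 1%N - T 0%N) + (p%:Z - m%:Z - 1) * T 1%N by ring.
apply: le_trans (_ : (1 + (p%:Z - m%:Z - 1)) * M <= _); last first.
  by rewrite ler_wpM2r //; lia.
rewrite [leRHS]mulrDl mul1r (le_trans (ler_normD _ _)) // lerD // normrM.
by rewrite ger0_norm ?ler_wpM2l //; lia.
Qed.

(** Over a constant, the window grows by [T 0] at each index until it holds [p] terms. *)
Lemma bM_win_cum M T m : bC M T -> bM (p%:Z * M) (sec q m (win p (cum T))).
Proof.
move=> TC; have [_ TM] := TC.
have evC n : (0 < n)%N -> cum T n = cum T 1 by rewrite !(cum_bC TC).
have tot n : (p < n)%N -> win p (cum T) n = p%:Z * T 0%N.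
  by move=> pn; rewrite win_settled // ltnW // !(cum_bC TC).
have far := sec_far m tot; split=> [n n0|]; first by rewrite !far.
exists (T 0%N < 0); rewrite (far 1%N) // sec0 win_settled // !(cum_bC TC).
have sg : `|T 0%N| = (-1) ^+ (T 0%N < 0)%R * T 0%N.
  exact: normrEsign.
have -> : (if (p <= m)%N then p%:Z * T 0%N else T 0%N + m%:Z * T 0%N) =
    (minn p m.+1)%:Z * T 0%N.
  case: leqP => pm; first by rewrite (minn_idPl _) // ltnW.
  by rewrite (minn_idPr _) // intS; ring.
rewrite ![(-1) ^+ _ * (_ * _)]mulrCA -sg.
have N0 := normr_ge0 (T 0%N); split.
- by rewrite mulr_ge0.
- by rewrite ler_wpM2r // lez_nat geq_minl.
by rewrite ler_wpM2l.
Qed.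

(** * Periodic states created by division by ['Phi_p] *)

Lemma affine_hit m u v : u * v = 1 %[mod p] -> exists k, forall c j, (c < p)%N ->
  ((m + u * j) %% p == c)%N = (j %% p == (k + v * c) %% p)%N.
Proof.
move=> uv; exists (v * (p - m %% p))%N => c j cp.
have mp : (m %% p < p)%N by rewrite ltn_mod.
have vu : forall x, v * (u * x) = x %[mod p].
  by move=> x; rewrite mulnA [(v * u)%N]mulnC -modnMml uv modnMml mul1n.
have uvx : forall x, u * (v * x) = x %[mod p].
  by move=> x; rewrite mulnA -modnMml uv modnMml mul1n.
have m0 : m + (p - m %% p) = 0 %[mod p].
  by rewrite -modnDml addnC subnK ?modnn ?mod0n // ltnW.
rewrite -{1}(modn_small cp); apply/eqP/eqP => E.
  have : v * (m + u * j) + v * (p - m %% p) = v * c + v * (p - m %% p) %[mod p].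
    by rewrite -modnDml -modnMmr E modnMmr modnDml.
  rewrite mulnDr -addnA [(v * (u * j) + _)%N]addnC addnA -mulnDr -modnDml -modnMmr m0.
  by rewrite modnMmr muln0 mod0n add0n vu => ->; rewrite addnC.
have uj : u * j = (p - m %% p) + c %[mod p].
  by rewrite -modnMmr E modnMmr mulnDr -modnDml uvx modnDml -modnDmr uvx modnDmr.
by rewrite -modnDmr uj modnDmr addnA -modnDml m0 modnDml add0n.
Qed.

(* The pattern [x, y - x, - y] at the residues 0, 1, 2, which is the image of
   [x / (1 - 'X) + y * 'X / (1 - 'X)] under [(1 - 'X)^2]. *)
Definition tri (x y : int) (n : nat) : int :=
  x * (n %% p == 0)%N%:Z + (y - x) * (n %% p == 1)%N%:Z - y * (n %% p == 2)%N%:Z.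

Lemma periodic_tri x y : periodic p (tri x y).
Proof. by move=> n; rewrite /tri modnDr. Qed.

Lemma sum3 (F : nat -> int) : (forall n, (2 < n)%N -> (n < p)%N -> F n = 0) ->
  \sum_(i < p) F i = F 0%N + F 1%N + F 2%N.
Proof.
move=> F0; rewrite -(big_mkord xpredT F) (big_cat_nat (n := 3)) //=.
rewrite [X in _ + X]big_nat [X in _ + X]big1 ?addr0 => [|i /andP[? ?]]; last exact: F0.
by rewrite !big_nat_recr //= big_geq // add0r.
Qed.

Lemma tri_small x y : [/\ tri x y 0%N = x, tri x y 1%N = y - x, tri x y 2%N = - y
  & forall n, (2 < n)%N -> (n < p)%N -> tri x y n = 0].
Proof.
rewrite /tri mod0n (modn_small p_gt1) (modn_small p_gt2); split; try by rewrite /=; ring.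
move=> n n2 np; rewrite modn_small //.
by case: n n2 np => [|[|[|n]]] // _ _ /=; ring.
Qed.

Lemma sum_step k : (k <= p)%N -> \sum_(n < p) (k <= n)%N%:Z = (p - k)%N%:Z.
Proof.
move=> kp; have := sum_arc 0 (leq_subr k p).
rewrite (reindex_inj rev_ord_inj) /= => <-; apply: eq_bigr => i _.
have ip := ltn_ord i; rewrite /arc add0n modn_small //; last by lia.
by congr (nat_of_bool _)%:Z; lia.
Qed.

Lemma sum_step_dist a b : (a <= p)%N -> (b <= p)%N ->
  \sum_(n < p) `|(a <= n)%N%:Z - (b <= n)%N%:Z| = `|a%:Z - b%:Z| :> int.
Proof.
wlog ab : a b / (a <= b)%N => [W ap bp|ap bp].
  case: (leqP a b) => [ab|/ltnW ba]; first exact: W.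
  by rewrite distrC -W //; apply: eq_bigr => i _; rewrite distrC.
rewrite (eq_bigr (fun n : 'I_p => (a <= n)%N%:Z - (b <= n)%N%:Z)).
  by rewrite sumrB !sum_step //; lia.
by move=> i _; rewrite ger0_norm //; lia.
Qed.

Lemma cum_hit k n : (k < p)%N -> (n < p)%N ->
  \sum_(i < n.+1) (i %% p == k)%N%:Z = (k <= n)%N%:Z :> int.
Proof.
move=> kp; elim: n => [|n IHn] np; first by rewrite big_ord1 mod0n; case: k kp.
by rewrite big_ord_recr (IHn (ltnW np)) (modn_small (m := n.+1)) /=; lia.
Qed.

(** The residues 0, 1, 2 are met at positions [k0], [k1], [k2], each [v] after the previous one
    modulo [p]. Partial sums are, up to sign, [x] between [k0] and [k1] plus [y] between [k1] and
    [k2]. *)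
Lemma sum_cum_tri m u v x y : u * v = 1 %[mod p] -> (0 < v)%N -> (v < p)%N ->
  exists d e : int, [/\ d = v%:Z \/ d = (p - v)%N%:Z, e = v%:Z \/ e = (p - v)%N%:Z,
    d + e <= p%:Z &
    \sum_(n < p) `|cum (sec u m (tri x y)) n| <= `|x| * d + `|y| * e].
Proof.
move=> uv v0 vp; have [k hit] := affine_hit m uv.
pose k0 := (k %% p)%N; pose k1 := ((k + v) %% p)%N; pose k2 := ((k + v * 2) %% p)%N.
have [k0p k1p k2p] : [/\ k0 < p, k1 < p & k2 < p]%N by rewrite !ltn_mod.
have next_mod a : ((a + v) %% p = a %% p + v \/ (a + v) %% p + p = a %% p + v)%N.
  rewrite -modnDml; have ap : (a %% p < p)%N by rewrite ltn_mod.
  case: (ltnP (a %% p + v) p) => [lt|ge]; first by left; rewrite modn_small.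
  right; rewrite -{1}(subnK ge) modnDr modn_small ?subnK //.
  by move: (a %% p)%N ap ge vp => b; clear; lia.
have k01 := next_mod k; have k12 := next_mod (k + v)%N.
rewrite -addnA addnn -muln2 -/k1 -/k2 in k12; rewrite -/k0 -/k1 in k01.
exists `|k0%:Z - k1%:Z|, `|k1%:Z - k2%:Z|; split.
- exact: wrap_dist vp k01.
- exact: wrap_dist vp k12.
- exact: wrap_dist2 k0p k2p vp k01 k12.
rewrite -(sum_step_dist (ltnW k0p) (ltnW k1p)) -(sum_step_dist (ltnW k1p) (ltnW k2p)).
rewrite !mulr_sumr -big_split /=; apply: ler_sum => n _.
have -> : cum (sec u m (tri x y)) n =
    x * ((k0 <= n)%N%:Z - (k1 <= n)%N%:Z) + y * ((k1 <= n)%N%:Z - (k2 <= n)%N%:Z).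
  have np := ltn_ord n.
  rewrite /cum (eq_bigr (fun i : 'I_n.+1 => x * (i %% p == k0)%N%:Z +
    (y - x) * (i %% p == k1)%N%:Z - y * (i %% p == k2)%N%:Z)); last first.
    by move=> i _; rewrite /sec /tri !hit ?p_gt1 // muln0 addn0 muln1.
  by rewrite sumrB big_split /= -!mulr_sumr !cum_hit //; ring.
by rewrite (le_trans (ler_normD _ _)) // !normrM.
Qed.

Lemma coprime_inverse u : coprime u p -> exists v, [/\ u * v = 1 %[mod p], (0 < v)%N & (v < p)%N].
Proof.
move=> cup; have u0 : (0 < u)%N.
  by case: u cup => //; rewrite /coprime gcd0n => /eqP pE; move: p_gt2; rewrite pE.
case: (egcdnP p u0) => a b E _; move: E; rewrite (eqP cup) => E.
have ap1 : u * (a %% p) = 1 %[mod p] by rewrite modnMmr mulnC E modnMDl.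
exists (a %% p)%N; split=> //; last by rewrite ltn_mod.
by rewrite lt0n; apply/eqP => a0; move: ap1; rewrite a0 muln0 mod0n modn_small.
Qed.

(** Sampling by [q] gives gaps [s] or [p - s], hence at most [mu]; for an arbitrary step only
    [d + e <= p] remains. *)
Lemma bZ_tri (N D D' x y : int) m :
  `|x| + `|y - x| + `|y| <= 2 * N ->
  (forall d e : int, 0 <= d -> 0 <= e -> d <= mu%:Z -> e <= mu%:Z -> d + e <= p%:Z ->
    `|x| * d + `|y| * e <= D) ->
  (forall d e : int, 0 <= d -> 0 <= e -> d + e <= p%:Z -> `|x| * d + `|y| * e <= D') ->
  bZ p N D D' (sec q m (tri x y)).
Proof.
move=> xyN xyD xyD'; have perT := periodic_tri x y; have [t0 t1 t2 t3] := tri_small x y.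
split; first exact: periodic_sec.
- by rewrite (sum_sec p_gt0 m cqp perT) sum3 // t0 t1 t2; ring.
- have perN : periodic p (fun i => `|tri x y i|) by move=> i; rewrite perT.
  rewrite (sum_periodic_affine p_gt0 m cqp perN) (sum3 (F := fun i => `|tri x y i|)).
    by rewrite t0 t1 t2 normrN.
  by move=> n n2 np; rewrite t3 ?normr0.
- have [d [e [dE eE de le_de]]] := sum_cum_tri m x y qs s_gt0 sp.
  by apply: le_trans le_de _; apply: xyD => //; lia.
move=> m' u cup; have cqu : coprime (q * u) p by rewrite coprimeMl cqp.
have [v [uv v0 vp]] := coprime_inverse cqu.
have [d [e [dE eE de le_de]]] := sum_cum_tri (m + q * m') x y uv v0 vp.
rewrite (eq_bigr (fun i : 'I_p => `|cum (sec (q * u) (m + q * m') (tri x y)) i|)).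
  by apply: le_trans le_de _; apply: xyD' => //; lia.
by move=> i _; rewrite (eq_cum (@sec_sec _ _ _ _ _)).
Qed.

Lemma pext_diff2 T : (forall n, (0 < n)%N -> T n = T 1%N) ->
  pext p (diff (diff T)) =1 tri (T 0%N) (T 1%N - T 0%N).
Proof.
move=> evT n; rewrite /pext /tri; move: (n %% p)%N (ltn_pmod n p_gt0) => k kp.
case: k kp => [|[|[|k]]] kp; rewrite /diff /=; try lia.
  by rewrite (evT 2%N) //; lia.
by rewrite (evT k.+3) // (evT k.+2) // (evT k.+1) //; lia.
Qed.

Lemma pext_diff T M : bC M T -> pext p (diff T) =1 tri (T 0%N) 0.
Proof.
move=> [T0 _] n; rewrite /pext /tri; move: (n %% p)%N => k.
case: k => [|[|[|k]]]; rewrite /diff /=; first by lia.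
- by rewrite (T0 1%N) //; lia.
- by rewrite (T0 2%N) // (T0 1%N) //; lia.
by rewrite (T0 k.+3) // (T0 k.+2) //; lia.
Qed.

Lemma bZ_pair M T m : bC M T -> bZ p M (mu%:Z * M) (p%:Z * M) (sec q m (pext p (diff T))).
Proof.
move=> TC; have [_ TM] := TC; have N0 := normr_ge0 (T 0%N).
rewrite (boolp.funext (pext_diff TC)); apply: bZ_tri.
- by rewrite sub0r normrN normr0; lia.
- by move=> d e d0 e0 dm em de; rewrite normr0 mul0r addr0; nia.
by move=> d e d0 e0 de; rewrite normr0 mul0r addr0; nia.
Qed.

Lemma bZ_mono M T m : bM M T ->
  bZ p M (mu%:Z * M) (p%:Z * M) (sec q m (pext p (diff (diff T)))).
Proof.
move=> [evT [u [a b c]]]; rewrite (boolp.funext (pext_diff2 evT)).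
have xy : `|T 0%N| + `|T 1%N - T 0%N| <= M.
  by case: u a b c; rewrite ?mul1r ?mulN1r; lia.
have := normr_ge0 (T 0%N); have := normr_ge0 (T 1%N - T 0%N) => y0 x0.
apply: bZ_tri.
- have := ler_normB (T 1%N - T 0%N) (T 0%N); lia.
- by move=> d e d0 e0 dm em de; nia.
by move=> d e d0 e0 de; nia.
Qed.

Lemma bZ_settled M T m : bO M T ->
  bZ p (2 * M) (p%:Z * M) (p%:Z * M) (sec q m (pext p (diff (diff T)))).
Proof.
move=> [evT [a b c]]; rewrite (boolp.funext (pext_diff2 evT)).
have := normr_ge0 (T 0%N); have := normr_ge0 (T 1%N - T 0%N) => y0 x0.
apply: bZ_tri.
- have := ler_normB (T 1%N - T 0%N) (T 0%N); lia.
- by move=> d e d0 e0 dm em de; nia.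
by move=> d e d0 e0 de; nia.
Qed.

Lemma bounded_two B L x y U m : periodic p U -> U 0%N = x -> U 1%N = y ->
  (forall n, (1 < n)%N -> (n < p)%N -> U n = 0) ->
  `|x| <= B -> `|y| <= B -> `|x - y| <= B -> `|x| + `|y| <= L ->
  bounded p B L (sec q m U).
Proof.
move=> perU U0 U1 U2 xB yB xyB xyL; apply: bounded_sec => //.
have B0 : 0 <= B by apply: le_trans (normr_ge0 x) xB.
have val i : [\/ U i = x, U i = y | U i = 0].
  rewrite -(periodic_mod i perU); have := ltn_pmod i p_gt0.
  case: (i %% p)%N => [|[|k]] kp; [constructor 1 | constructor 2 | constructor 3] => //.
  exact: U2.
split=> //.
- by move=> i; case: (val i) => ->; rewrite ?normr0.
- by move=> i j; case: (val i) => ->; case: (val j) => ->; lia.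
rewrite (sum3 (F := fun i => `|U i|)) ?U0 ?U1 ?U2 ?normr0 ?addr0 // => n n2 np.
by rewrite U2 ?normr0 // ltnW.
Qed.

Lemma bounded_atom M T m : bC M T -> bounded p M M (sec q m (pext p T)).
Proof.
move=> [T0 TM]; have M0 := normr_ge0 (T 0%N).
apply: (@bounded_two _ _ (T 0%N) 0); rewrite ?subr0 ?normr0 ?addr0 //; try by lia.
- exact: periodic_pext.
- by rewrite /pext mod0n.
- by rewrite /pext modn_small ?p_gt1 // T0.
by move=> n n1 np; rewrite /pext modn_small // T0 // ltnW.
Qed.

Lemma bounded_pext_diff B L T m : (forall n, (0 < n)%N -> T n = T 1%N) ->
  `|T 0%N| <= B -> `|T 1%N - T 0%N| <= B -> `|T 0%N - (T 1%N - T 0%N)| <= B ->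
  `|T 0%N| + `|T 1%N - T 0%N| <= L ->
  bounded p B L (sec q m (pext p (diff T))).
Proof.
move=> evT a b c d; apply: bounded_two a b c d.
- exact: periodic_pext.
- by rewrite /pext mod0n /diff subr0.
- by rewrite /pext modn_small ?p_gt1.
by move=> n n1 np; rewrite /pext modn_small // diff_tail.
Qed.

Lemma bounded_mono M T m : bM M T -> bounded p M M (sec q m (pext p (diff T))).
Proof.
move=> [evT [u [a b c]]]; apply: bounded_pext_diff => //;
  by case: u a b c; rewrite ?mul1r ?mulN1r; lia.
Qed.

Lemma bounded_settled M T m : bO M T ->
  bounded p (2 * M) (2 * M) (sec q m (pext p (diff T))).
Proof. by move=> [evT [a b c]]; apply: bounded_pext_diff => //; lia. Qed.

Lemma sum_split3 (F : nat -> int) n1 n2 : (n1 <= n2)%N -> (n2 <= p)%N ->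
  \sum_(i < p) F i =
    \sum_(0 <= n < n1) F n + \sum_(n1 <= n < n2) F n + \sum_(n2 <= n < p) F n.
Proof.
move=> n12 n2p; rewrite -(big_mkord xpredT F).
by rewrite -!big_cat_nat // (leq_trans n12).
Qed.

Lemma range_le (T : nat -> int) n1 n2 : (n1 <= n2)%N -> (n2 <= p)%N ->
  `|\sum_(n1 <= i < n2) T i| <= \sum_(i < p) `|T i|.
Proof.
move=> n12 n2p; apply: le_trans (ler_norm_sum _ _ _) _.
rewrite (sum_split3 (fun i => `|T i|) n12 n2p).
have ge0 a b : 0 <= \sum_(a <= i < b) `|T i| by apply: sumr_ge0.
by rewrite addrAC lerDr addr_ge0.
Qed.

(** A range and its complement have opposite sums, so twice one of them is at most the sum of
    absolute values. *)
Lemma range_half (T : nat -> int) N n1 n2 : (n1 <= n2)%N -> (n2 <= p)%N ->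
  \sum_(i < p) T i = 0 -> \sum_(i < p) `|T i| <= 2 * N ->
  `|\sum_(n1 <= i < n2) T i| <= N.
Proof.
move=> n12 n2p; rewrite (sum_split3 T n12 n2p) (sum_split3 (fun i => `|T i|) n12 n2p).
have := ler_norm_sum (index_iota 0 n1) T xpredT.
have := ler_norm_sum (index_iota n1 n2) T xpredT.
have := ler_norm_sum (index_iota n2 p) T xpredT.
move: (\sum_(0 <= n < n1) T n) (\sum_(n1 <= n < n2) T n) (\sum_(n2 <= n < p) T n).
move: (\sum_(0 <= n < n1) _) (\sum_(n1 <= n < n2) _) (\sum_(n2 <= n < p) _).
by clear; lia.
Qed.

(** As [q * s = 1] modulo [p], the shift by 1 becomes a shift by [s] after sampling, so [g = s],
    which respects [mu]. The missing term of index -1 is noticed only for [m = 0]. *)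
Lemma bD_diff M L K T m : bounded p M L T ->
  \sum_(x < p) (`|T x| + T x) <= 2 * K -> \sum_(x < p) (`|T x| - T x) <= 2 * K ->
  bD p mu M L K true (sec q m (diff T)).
Proof.
move=> TP TK TK'; have [perT _ _ _] := TP.
have back n : T (n.+1 + q * (p - s))%N = T n.
  have z : q * (p - s) + 1 = 0 %[mod p].
    by rewrite -modnDmr -qs modnDmr -mulnDr subnK ?modnMl ?mod0n // ltnW.
  by apply: periodic_eqmod perT _; rewrite addSnnS -addn1 -modnDmr z mod0n addn0.
have perP : periodic p (fun i => `|T i| + T i) by move=> i; rewrite perT.
have perN : periodic p (fun i => `|T i| - T i) by move=> i; rewrite perT.
exists (sec q m T), s, (m == 0%N); split=> //; split.
- exact: bounded_sec.
- by rewrite (sum_periodic_affine p_gt0 m cqp perP).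
- by rewrite (sum_periodic_affine p_gt0 m cqp perN).
- by rewrite s_gt0.
split=> [|n].
  rewrite !sec0 /sec; case: m => [|m] /=; first by rewrite /diff.
  by rewrite back.
rewrite /sec mulnDr addnA.
have -> : (m + q * n.+1 = (m + q * n.+1).-1.+1)%N.
  by rewrite prednK // mulnS; move: pq; clear; lia.
by rewrite back.
Qed.

Lemma bD_diff_bounded M L T m : bounded p M L T -> bD p mu M L L true (sec q m (diff T)).
Proof.
move=> TP; have [_ _ _ TL] := TP; apply: bD_diff => //.
  apply: le_trans (_ : \sum_(x < p) 2 * `|T x| <= _); last by rewrite -mulr_sumr ler_wpM2l.
  by apply: ler_sum => i _; lia.
apply: le_trans (_ : \sum_(x < p) 2 * `|T x| <= _); last by rewrite -mulr_sumr ler_wpM2l.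
by apply: ler_sum => i _; lia.
Qed.

Lemma bC_gap_periodic M T m : periodic p T -> (forall i, `|T i| <= M) ->
  bC M (sec q m (gap p T)).
Proof.
move=> perT TM; split=> [n n0|].
  by apply: (sec_far m (c := 0)) => // k pk; rewrite gap_periodic // ltnW.
rewrite sec0; case: (leqP p m) => [pm|mp].
  by rewrite gap_periodic // normr0 (le_trans _ (TM 0%N)).
by rewrite /gap leqNgt mp subr0.
Qed.

Lemma bO_win_bounded M L T m : bounded p M L T -> bO L (sec q m (win p T)).
Proof.
by move=> [perT _ _ TL]; apply: bO_win => // n1 n2 n12 n2p; apply: le_trans TL; apply: range_le.
Qed.

Lemma bC_win_settled B T m : periodic p (cum T) -> (forall i, `|cum T i| <= B) ->
  bC B (sec q m (win p T)).
Proof.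
move=> perC CB; exact: (bC_gap_periodic m perC CB).
Qed.

Lemma bZ_cum_le N D D' T n : bZ p N D D' T -> `|cum T n| <= N.
Proof.
move=> [perT sT aT _ _]; have perC := periodic_cum perT sT.
by rewrite -(periodic_mod n perC) cum_nat; apply: range_half => //; rewrite ltn_mod.
Qed.

Lemma bZ_le N D D' T n : bZ p N D D' T -> `|T n| <= N.
Proof.
move=> [perT sT aT _ _]; rewrite -(periodic_mod n perT).
have -> : T (n %% p)%N = \sum_(n %% p <= i < (n %% p).+1) T i by rewrite big_nat1.
by apply: range_half => //; rewrite ltn_mod.
Qed.

Lemma bounded_cum N D D' T m : bZ p N D D' T -> bounded p N D (sec q m (cum T)).
Proof.
move=> ZT; have [perT sT aT TD _] := ZT; have perC := periodic_cum perT sT.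
apply: bounded_sec => //; split=> //; first by move=> i; apply: bZ_cum_le ZT.
move=> i j; rewrite -(periodic_mod i perC) -(periodic_mod j perC).
move: (i %% p)%N (j %% p)%N (ltn_pmod i p_gt0) (ltn_pmod j p_gt0) => {}i {}j ip jp.
rewrite !cum_nat; case: (leqP j i) => ij.
  rewrite [X in X - _](big_cat_nat (n := j.+1)) //= addrAC subrr add0r.
  by apply: le_trans (ler_norm _) _; apply: range_half.
rewrite [X in _ - X](big_cat_nat (n := i.+1)) //=; last exact: ltnW.
rewrite opprD addNKr; apply: le_trans (ler_norm _) _; rewrite normrN.
by apply: range_half => //; exact: ltnW.
Qed.

(** Both signs of a zero-sum [T] have equal mass, which gives [K = N] instead of [2 * N]. *)
Lemma bD_diff_bZ N D D' T m : bZ p N D D' T ->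
  bD p mu (2 * N) (2 * N) N true (sec q m (diff T)).
Proof.
move=> ZT; have [perT sT aT TD _] := ZT; apply: bD_diff.
- split=> // [i|i j]; first by have := bZ_le i ZT; lia.
  by have := bZ_le i ZT; have := bZ_le j ZT; lia.
- by rewrite big_split /= sT addr0.
by rewrite sumrB sT subr0.
Qed.

Lemma bC_win_bZ N D D' T m : bZ p N D D' T -> bC N (sec q m (win p T)).
Proof.
move=> ZT; have [perT sT _ _ _] := ZT.
by apply: bC_win_settled => [|i]; [exact: periodic_cum | exact: bZ_cum_le ZT].
Qed.

Lemma bC_gap_bZ N D D' T m : bZ p N D D' T -> bC N (sec q m (gap p T)).
Proof.
by move=> ZT; have [perT _ _ _ _] := ZT; apply: bC_gap_periodic => // i; exact: bZ_le ZT.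
Qed.

Lemma bO_win_cum_bZ N D D' T m : bZ p N D D' T -> bO D (sec q m (win p (cum T))).
Proof.
move=> [perT sT _ TD _]; apply: bO_win => [|n1 n2 n12 n2p]; first exact: periodic_cum.
by apply: le_trans TD; apply: range_le.
Qed.

Lemma bD_periodic_cum M L K now T : bD p mu M L K now T -> periodic p (cum T).
Proof.
move=> [f [g [imp [[[perf _ _ _] _ _ /andP[g0 gp] fT] _]]]] n.
rewrite !(cum_window p_gt0 _ perf g0 gp fT); apply: eq_bigr => x _.
by rewrite /weight addnAC periodic_arc.
Qed.

Lemma bD_cum M L K now T B : B = mu%:Z * M \/ B = L -> bD p mu M L K now T ->
  (forall n, `|cum T n| <= B) /\ (forall i j, cum T i - cum T j <= B).
Proof.
move=> BE [f [g [imp [[fP fK fK' /andP[g0 gp] fT] _]]]].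
case: BE => ->; split=> [n|i j].
- exact: (cum_window_hull p_gt0 p_mu g0 gp fP fT fK fK').
- exact: (cumB_window_hull p_gt0 p_mu g0 gp fP fT fK fK').
- exact: (cum_window_sup p_gt0 p_mu g0 gp fP fT fK fK').
- exact: (cumB_window_sup p_gt0 p_mu g0 gp fP fT fK fK').
Qed.

Lemma bounded_cum_bD M L K now T B m : B = mu%:Z * M \/ B = L -> bD p mu M L K now T ->
  bounded p B (p%:Z * B) (sec q m (cum T)).
Proof.
move=> BE DT; have [CB CsB] := bD_cum BE DT.
apply: bounded_sec => //; split=> //; first exact: bD_periodic_cum DT.
apply: le_trans (_ : \sum_(x < p) B <= _); first exact: ler_sum.
by rewrite sumr_const card_ord -mulr_natl natz.
Qed.

Lemma bC_win_bD M L K now T B m : B = mu%:Z * M \/ B = L -> bD p mu M L K now T ->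
  bC B (sec q m (win p T)).
Proof.
move=> BE DT; have [CB _] := bD_cum BE DT.
by apply: bC_win_settled => //; exact: bD_periodic_cum DT.
Qed.

Lemma bO_win_cum_bD M L K (now : bool) T B m :
  [\/ B = mu%:Z * mu%:Z * M, B = p%:Z * K | now /\ B = mu%:Z * L] ->
  bD p mu M L K now T -> bO B (sec q m (win p (cum T))).
Proof.
move=> BE DT; apply: bO_win => [|n1 n2 n12 n2p]; first exact: bD_periodic_cum DT.
case: DT => [f [g [imp [[fP fK fK' /andP[g0 gp] fT] nowP]]]].
case: BE => [->|->|[/nowP[a b] ->]].
- exact: (range_window_hull p_gt0 p_mu g0 gp fP fT fK fK' n12 n2p).
- exact: (range_window_parts p_gt0 g0 gp fP fT fK fK' n12 n2p).
exact: (range_window_sup p_gt0 g0 gp fP fT n12 n2p a b).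
Qed.

(** * Soundness of the abstract transitions *)

Definition mval (x : monomial) : int := let: (c, i, m) := x in (c * p ^ i * mu ^ m)%N%:Z.

Lemma mval_mulp x : mval (mulp x) = p%:Z * mval x.
Proof. by case: x => [[c i] m] /=; rewrite -PoszM expnS; congr Posz; lia. Qed.

Lemma mval_mulmu x : mval (mulmu x) = mu%:Z * mval x.
Proof. by case: x => [[c i] m] /=; rewrite -PoszM expnS; congr Posz; lia. Qed.

Lemma mval_mul2 x : mval (mul2 x) = 2 * mval x.
Proof. by case: x => [[c i] m] /=; rewrite -PoszM -mul2n !mulnA. Qed.

Definition sem (st : astate) : (nat -> int) -> Prop :=
  match st with
  | SC M => bC (mval M)
  | SO M => bO (mval M)
  | SM M => bM (mval M)
  | SV M L => bounded p (mval M) (mval L)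
  | SZ N D D' => bZ p (mval N) (mval D) (mval D')
  | SD M L K now => bD p mu (mval M) (mval L) (mval K) now
  end.

Lemma letter_settled (e e' : bool) T : (forall n, (0 < n)%N -> T n = T 1%N) ->
  (~~ e && e' -> T 1%N = 0) ->
  letter p e e' false true T (pext p (iter (1 + e - e') diff T)).
Proof.
move=> evT T1; apply: letter_pext => // n pn; case: e e' T1 => [] [] /= T1.
- by rewrite diff_tail //; lia.
- rewrite /diff; case: n pn => [|[|[|n]]] pn; (try lia).
  by rewrite (evT n.+3) // (evT n.+2) // (evT n.+1) //; lia.
- by rewrite evT ?T1 //; lia.
by rewrite diff_tail //; lia.
Qed.

Lemma bC_settled M T : bC M T -> (forall n, (0 < n)%N -> T n = T 1%N) /\ T 1%N = 0.
Proof. by move=> [T0 _]; split=> [n n0|]; rewrite !T0. Qed.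

Local Notation mvalE := (mval_mulp, mval_mulmu, mval_mul2).

Lemma step_sound_0 st st' (e e' f : bool) T : sem st T -> List.In st' (step st e e' f f) ->
  exists U, letter p e e' f f T U /\ forall m, sem st' (sec q m U).
Proof.
case: (eqVneq e e') => [<-|].
  move=> stT st'P; exists T; split=> [|m]; first exact: letter00.
  move: stT st'P; case: st => [M|M|M|M L|N D D'|M L K now] /=; rewrite !eqxx => stT [<-|//] /=.
  - exact: bC_sec.
  - exact: bO_sec.
  - exact: bM_sec.
  - exact: bounded_sec.
  - exact: bZ_sec stT.
  - exact: bD_sec stT.
case: e e' => [] [] // _ stT st'P.
  exists (diff T); split=> [|m]; first exact: letterP0.
  move: stT st'P; case: st => [M|M|M|M L|N D D'|M L K now] /=; rewrite !eqxx => stT // [<-|//] /=.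
  - exact/bC_diff/bC_bO.
  - exact: bC_diff.
  - exact/bC_diff/bM_bO.
  - exact: bD_diff_bounded.
  - by rewrite mvalE; exact: bD_diff_bZ stT.
exists (cum T); split=> [|m]; first exact: letterN0.
move: stT st'P; case: st => [M|M|M|M L|N D D'|M L K now] /=; rewrite !eqxx => stT //.
- by case=> [<-|//] /=; exact: bO_cum.
- by case=> [<-|//] /=; exact: bounded_cum stT.
case=> [<-|[<-|//]] /=; rewrite !mvalE.
  by apply: bounded_cum_bD stT; left.
by apply: bounded_cum_bD stT; right.
Qed.

Lemma step_sound_P st st' (e e' : bool) T : sem st T -> List.In st' (step st e e' true false) ->
  exists U, letter p e e' true false T U /\ forall m, sem st' (sec q m U).
Proof.
case: (eqVneq e e') => [<-|].
  move=> stT st'P; exists (win p T); split=> [|m]; first exact: letter0P.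
  move: stT st'P; case: st => [M|M|M|M L|N D D'|M L K now] /=; rewrite ?eqxx => stT.
  - by case=> [<-|//] /=; exact: bC_win.
  - by case=> [<-|//] /=; rewrite mvalE; exact: bO_win_settled.
  - by case=> [<-|//] /=; rewrite mvalE; exact/bO_win_settled/bM_bO.
  - by case=> [<-|//] /=; exact: bO_win_bounded stT.
  - by case=> [<-|//] /=; exact: bC_win_bZ stT.
  - case=> [<-|[<-|//]] /=; rewrite ?mvalE.
      by apply: bC_win_bD stT; left.
    by apply: bC_win_bD stT; right.
case: e e' => [] [] // _ stT st'P.
  exists (gap p T); split=> [|m]; first exact: letterPP.
  move: stT st'P; case: st => [M|M|M|M L|N D D'|M L K now] /= stT // [<-|//] /=.
  - exact/bC_gap/bC_bO.
  - exact: bC_gap.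
  - exact/bC_gap/bM_bO.
  - by case: stT => perT TM _ _; exact: bC_gap_periodic.
  - exact: bC_gap_bZ stT.
exists (win p (cum T)); split=> [|m]; first exact: letterNP.
move: stT st'P; case: st => [M|M|M|M L|N D D'|M L K now] /= stT //.
- by case=> [<-|//] /=; rewrite mvalE; exact: bM_win_cum.
- by case=> [<-|//] /=; exact: bO_win_cum_bZ stT.
case=> [<-|[<-|]] /=; rewrite ?mvalE ?mulrA.
- by apply: bO_win_cum_bD stT; constructor 1.
- by apply: bO_win_cum_bD stT; constructor 2.
case: now stT => stT //= [<-|//] /=; rewrite mvalE.
by apply: bO_win_cum_bD stT; constructor 3.
Qed.

Lemma step_sound_N st st' (e e' : bool) T : sem st T -> List.In st' (step st e e' false true) ->
  exists U, letter p e e' false true T U /\ forall m, sem st' (sec q m U).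
Proof.
move=> stT st'P; exists (pext p (iter (1 + e - e') diff T)).
move: stT st'P; case: st => [M|M|M|M L|N D D'|M L K now] /= stT //.
- have [evT T1] := bC_settled stT.
  have L : letter p e e' false true T (pext p (iter (1 + e - e') diff T)).
    exact: letter_settled.
  case: e e' L => [] [] L /= [<-|//]; split=> // m /=; rewrite ?mvalE //.
  + exact: bZ_pair.
  + exact/bZ_settled/bC_bO.
  + exact: bounded_atom.
  + exact: bZ_pair.
- have evT := stT.1.
  case: e e' => [] [] //= [<-|//]; (split; first by apply: letter_settled) => m /=; rewrite !mvalE.
  + exact: bounded_settled.
  + exact: bZ_settled.
  + exact: bounded_settled.
- have evT := stT.1.
  case: e e' => [] [] //= [<-|//]; (split; first by apply: letter_settled) => m /=; rewrite ?mvalE.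
  + exact: bounded_mono.
  + exact: bZ_mono.
  + exact: bounded_mono.
Qed.

Lemma step_sound st st' (e e' f f' : bool) T : sem st T -> List.In st' (step st e e' f f') ->
  exists U, letter p e e' f f' T U /\ forall m, sem st' (sec q m U).
Proof.
case: f f' => [] []; [exact: step_sound_0 | exact: step_sound_P | exact: step_sound_N |].
exact: step_sound_0.
Qed.

Hypothesis mu_p : (mu < p)%N.

Lemma below_sound t x : below t x -> mval x <= (p * mu ^ t)%N%:Z.
Proof.
have mu_gt1 : (1 < mu)%N by lia.
have mu_gt0 := ltnW mu_gt1.
have p_mu2 : (p <= mu * mu)%N.
  by apply: leq_trans (_ : mu * 2 <= _)%N; rewrite ?leq_mul2l ?mu_gt1 ?orbT // muln2 ltnW.
have pow c k : (c <= 2 ^ k -> c <= mu ^ k)%N.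
  by move=> ck; apply: leq_trans ck _; case: k => // k; rewrite leq_exp2r.
case: x => [[c [|i]] m] /= /andP[mt /pow ct]; rewrite lez_nat.
  rewrite expn0 muln1; apply: leq_trans (_ : mu * mu ^ t <= _)%N; last first.
    by rewrite leq_mul2r (ltnW mu_p) orbT.
  by rewrite -expnS -[in leqRHS](subnK mt) expnD leq_mul2r ct orbT.
rewrite expnS mulnCA -mulnA leq_mul2l; apply/orP; right.
have pi : (p ^ i <= mu ^ i.*2)%N.
  by rewrite -muln2 mulnC expnM -mulnn; case: (i) => // k; rewrite leq_exp2r.
rewrite -[in leqRHS](subnK mt) expnD -mulnA; apply: leq_mul => //.
by rewrite expnD mulnC leq_mul2l pi orbT.
Qed.

Lemma check_sound t w st T : check t w st -> sem st T ->
  forall n, `|act (wpoly p q 0 w) T n| <= (p * mu ^ t)%N%:Z.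
Proof.
elim: w st T => [|[e f] w IHw] st T.
  move=> ck stT n; rewrite act1.
  case: st ck stT => // M /below_sound/= Mt.
  - move=> [T0 TM]; case: n => [|n]; first exact: le_trans Mt.
    by rewrite T0 // normr0 (le_trans _ Mt) // (le_trans _ TM).
  - move=> [evT [a b _]]; case: n => [|n]; first exact: le_trans Mt.
    by rewrite evT // (le_trans b).
  move=> /bM_bO[evT [a b _]]; case: n => [|n]; first exact: le_trans Mt.
  by rewrite evT // (le_trans b).
move=> /has_in[st' st'P ck] stT n.
have [U [L UP]] := step_sound stT st'P.
have q_gt0 : (0 < q)%N by exact: prime_gt0.
have nq : (n %% q < q)%N by rewrite ltn_mod.
have p_neq_q : p != q by rewrite ltn_eqF // ltnW.
rewrite (divn_eq n q) addnC mulnC.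
by rewrite (act_wpoly_cons (n %/ q) pr_p pr_q p_neq_q nq L); exact: IHw ck _ _.
Qed.

(** * The alternating word *)

Hypothesis mu_s : mu = s \/ mu = (p - s)%N.

(** Two differences and periodic extension leave pulses [c] and [- c] at the residues 0 and 1, met
    at [a] and [a + s] modulo [p]. The partial sums are [c] or [- c] in between, so their total over
    a period is the distance times [c], up to sign. *)
Lemma const_two_steps (c : int) : exists m (V : nat -> int),
  [/\ (m < q)%N, V =1 sec q m (pext p (diff (diff (fun=> c)))), periodic p (cum V)
    & `|\sum_(n < p) cum V n| = mu%:Z * `|c|].
Proof.
(* The position is chosen to make the distance [mu]: without wrap for [mu = s], and with [a + s]
   wrapping to 0 for [mu = p - s]. *)
have [a [ap aE]] : exists a, (a < p)%N /\ `|((a + s) %% p)%N%:Z - a%:Z| = mu%:Z.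
  case: mu_s => ->; [exists 0%N | exists (p - s)%N].
    by rewrite add0n modn_small //; split=> //; rewrite subr0.
  rewrite subnK ?(ltnW sp) // modnn sub0r normrN; split=> //.
  by rewrite ltn_subrL s_gt0.
(* Solves [m + q * a = 0] modulo [p], so that residue 0 is met at [a]. *)
pose m := (q * (p - a) %% p)%N.
have mq : (m < q)%N by rewrite (ltn_trans _ (ltnW pq)) // ltn_mod.
have [k hit] := affine_hit m qs.
have kE : (k %% p)%N = a.
  have := hit 0%N a p_gt0; rewrite muln0 addn0 [(a %% p)%N]modn_small // => E.
  apply/eqP; rewrite eq_sym -E /m modnDml -mulnDr subnK ?(ltnW ap) //.
  by rewrite modnMl.
have VE : sec q m (pext p (diff (diff (fun=> c)))) =1
    fun j => c * (j %% p == a)%N%:Z - c * (j %% p == (a + s) %% p)%N%:Z.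
  move=> j; rewrite /sec (pext_diff2 (T := fun=> c)) // subrr /tri !hit //.
  have k1 : ((k + s) %% p = (a + s) %% p)%N by rewrite -modnDml kE.
  by rewrite muln0 addn0 muln1 kE k1; ring.
exists m, (sec q m (pext p (diff (diff (fun=> c))))); split=> //.
  apply: periodic_cum; first exact/periodic_sec/periodic_pext.
  rewrite (sum_sec p_gt0 m cqp (periodic_pext _ _)).
  have [t0 t1 t2 t3] := tri_small c 0.
  rewrite (eq_bigr (fun i : 'I_p => tri c 0 i)) => [|i _].
    by rewrite sum3 // t0 t1 t2; ring.
  by rewrite (pext_diff2 (T := fun=> c)) // subrr.
have a'p : ((a + s) %% p < p)%N by rewrite ltn_mod.
rewrite (eq_bigr (fun n : 'I_p => c * (a <= n)%N%:Z - c * ((a + s) %% p <= n)%N%:Z)).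
  rewrite sumrB -!mulr_sumr !sum_step 1?ltnW // -mulrBr normrM mulrC -aE; congr (_ * _).
  by rewrite -!subzn 1?ltnW //; congr `|_|; ring.
move=> n _; rewrite (eq_cum VE) /cum sumrB -!mulr_sumr.
by rewrite !(cum_hit _ (ltn_ord n)).
Qed.

Fixpoint alternating k : seq (bool * bool) :=
  if k is k'.+1 then [:: (false, true), (true, false) & alternating k'] else [::].

Lemma const_alternating k (c : int) : exists n,
  `|act (wpoly p q 0 ((true, false) :: alternating k)) (fun=> c) n| = mu%:Z ^+ k * `|c|.
Proof.
have q_gt0 : (0 < q)%N by exact: prime_gt0.
have p_neq_q : p != q by rewrite ltn_eqF // ltnW.
elim: k c => [|k IHk] c.
  exists (0 + q * 0)%N.
  have L : letter p true false false false (fun=> c) (diff (fun=> c)) by exact: letterP0.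
  rewrite (act_wpoly_cons (w := [::]) 0 pr_p pr_q p_neq_q q_gt0 L).
  by rewrite act1 /sec muln0 addn0 /diff subr0 mul1r.
have [m [V [mq VE perC sumC]]] := const_two_steps c.
pose t := \sum_(n < p) cum V n.
(* The class [p] at the second letter samples the window only where it is full, so the new state is
   the constant [t], of size [mu * |c|]. *)
have [n nE] := IHk t; exists (m + q * (p + q * n))%N.
have L1 : letter p true false false true (fun=> c) (pext p (diff (diff (fun=> c)))).
  exact: (@letter_settled true false).
rewrite (act_wpoly_cons (w := alternating k.+1) _ pr_p pr_q p_neq_q mq L1).
rewrite -(act_ext _ (fun i _ => VE i)).
have L2 : letter p false true true false V (win p (cum V)) by exact: letterNP.
have pq' : (p < q)%N by exact: ltnW.
rewrite (act_wpoly_cons (w := (true, false) :: alternating k) _ pr_p pr_q p_neq_q pq' L2).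
rewrite (@act_ext _ _ (fun=> t)) => [|i _]; last by rewrite /sec win_periodic ?leq_addr.
by rewrite nE sumC exprS; ring.
Qed.

(** The first pair of letters turns the unit pulse into a window over the constant 1, which sampled
    on the class [p] is the constant [p]. *)
Lemma alternating_height k : exists n,
  `|act (wpoly p q 0 (alternating k.+1)) (fun n => (n == 0)%N%:Z) n| = (p * mu ^ k)%N%:Z.
Proof.
have p_neq_q : p != q by rewrite ltn_eqF // ltnW.
have pq' : (p < q)%N by exact: ltnW.
have [n nE] := const_alternating k p%:Z.
have dC : bC 1 (fun n => (n == 0)%N%:Z) by split=> // -[].
exists (p + q * n)%N.
have L : letter p false true true false (fun n => (n == 0)%N%:Z)
    (win p (cum (fun n => (n == 0)%N%:Z))) by exact: letterNP.
rewrite (act_wpoly_cons (w := (true, false) :: alternating k) _ pr_p pr_q p_neq_q pq' L).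
rewrite (@act_ext _ _ (fun=> p%:Z)) => [|i _].
  by rewrite nE -[RHS]natz natrM natrX !natz mulrC.
by rewrite /sec win_settled ?leq_addr => [|j j0]; rewrite !(cum_bC dC) // mulr1.
Qed.

End Transitions.

(** * Comparison of the maximal heights *)

Lemma act_delta (g : {poly int}) n : act g (fun i => (i == 0)%N%:Z) n = g`_n.
Proof.
rewrite /act big_ord_recr /= subnn mulr1 big1 ?add0r // => i _.
by rewrite subn_eq0 leqNgt ltn_ord mulr0.
Qed.

Lemma size_alternating k : size (alternating k) = k.*2.
Proof. by elim: k => //= k ->. Qed.

(** The alternating word has length [b + 1] for odd [b] and [b] for even [b], where a trivial letter
    pads it. *)
Lemma half_pred_double b : (0 < b)%N -> ((b.-1)./2.+1.*2 + ~~ odd b)%N = b.+1.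
Proof. lia. Qed.

Lemma abs_coef_le_B p r b w n : prime p -> prime r -> p != r -> size w = b.+1 ->
  (`|(wpoly p r 0 w)`_n| <= (B (p * r ^ b))%:Z :> int).
Proof.
move=> pr_p pr_r p_neq_r sz.
have [|_ ub] := @B_is_max_height (p * r ^ b).
  by rewrite muln_gt0 expn_gt0 !prime_gt0.
have /height_leP/(_ n) := ub _ (wpoly_dvdpZ pr_p pr_r p_neq_r sz).
by rewrite -lez_nat abszE.
Qed.

(** One inequality suffices, the hypotheses being symmetric in [q] and [r]. A good word over [q] is
    simulated over [r]; any other is bounded by what the alternating word attains over [r], whose
    inverse modulo [p] is [s] or [p - s]. *)
Lemma B_le_of_eqmod p q r b : prime p -> prime q -> prime r -> odd p -> odd q -> odd r ->
  (p < q)%N -> (p < r)%N -> (q = r %[mod p] \/ (p %| q + r)%N) -> (0 < b)%N -> (b <= 5)%N ->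
  (B (p * q ^ b) <= B (p * r ^ b))%N.
Proof.
move=> pr_p pr_q pr_r odd_p odd_q odd_r pq pr qr b_gt0 b_le5.
have p_gt2 : (2 < p)%N by rewrite odd_prime_gt2.
have p_neq_q : p != q by rewrite ltn_eqF.
have p_neq_r : p != r by rewrite ltn_eqF.
have p1_lt k : odd k -> (p < k)%N -> (p.+1 < k)%N.
  by move=> ok pk; rewrite ltn_neqAle pk andbT; apply: contraTN ok => /eqP<-; rewrite /= odd_p.
have cop k : prime k -> (p < k)%N -> coprime k p.
  by move=> pr_k pk; rewrite prime_coprime // dvdn_prime2 // gtn_eqF.
have [s [qs s_gt0 sp]] := coprime_inverse p_gt2 (cop q pr_q pq).
pose mu := maxn s (p - s).
have p_mu : (p < mu.*2)%N.
  have : (mu.*2 != p)%N by apply/eqP => E; move: odd_p; rewrite -E odd_double.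
  by rewrite /mu; lia.
have [s_mu ps_mu] : (s <= mu)%N /\ (p - s <= mu)%N by rewrite leq_maxl leq_maxr.
have mu_p : (mu < p)%N by rewrite gtn_max sp ltn_subrL s_gt0 prime_gt0.
have mu_s : mu = s \/ mu = (p - s)%N by rewrite /mu; lia.
pose k := (b.-1)./2.
have lower : (p * mu ^ k <= B (p * r ^ b))%N.
  have [s' [rs s'_gt0 s'p s'E]] : exists s', [/\ r * s' = 1 %[mod p], (0 < s')%N, (s' < p)%N
      & s' = s \/ s' = (p - s)%N].
    case: qr => [E|dvd_qr]; [exists s | exists (p - s)%N]; split=> //; try by [left | right].
    - by rewrite -modnMml -E modnMml.
    - apply/eqP; rewrite -qs -(eqn_modDr (r * s)) -mulnDr subnK ?(ltnW sp) // -mulnDl.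
      by rewrite modnMl eq_sym; apply: dvdn_mulr.
    - by rewrite subn_gt0.
    - by rewrite ltn_subrL s_gt0 prime_gt0.
  have s'_mu : (s' <= mu)%N by case: s'E => ->.
  have ps'_mu : (p - s' <= mu)%N by case: s'E => ->; rewrite ?subKn ?(ltnW sp).
  have mu_s' : mu = s' \/ mu = (p - s')%N.
    by case: s'E => ->; rewrite ?subKn ?(ltnW sp) //; case: mu_s; [right | left].
  have [n nE] := alternating_height pr_p pr_r p_gt2 (p1_lt _ odd_r pr) (cop r pr_r pr) s'_gt0
    s'p rs p_mu s'_mu ps'_mu mu_s' k.
  rewrite -lez_nat -nE act_delta.
  pose w := if odd b then alternating k.+1 else rcons (alternating k.+1) (false, false).
  have -> : wpoly p r 0 (alternating k.+1) = wpoly p r 0 w.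
    by rewrite /w; case: ifP => // _; rewrite wpoly_rcons00.
  apply: abs_coef_le_B => //; have := half_pred_double b_gt0; rewrite -/k /w.
  by case: (odd b) => [<-|<-]; rewrite ?size_rcons size_alternating ?addn1 ?addn0.
have pqb_gt0 : (0 < p * q ^ b)%N by rewrite muln_gt0 expn_gt0 !prime_gt0.
have [[f f_dvd <-] _] := B_is_max_height pqb_gt0.
have [u [w [sz ->]]] := dvdpZ_wpoly pr_p pr_q p_neq_q f_dvd.
apply/height_leP => n; rewrite abs_coef_signM -lez_nat abszE -act_delta.
have := all_wordsP (words_checked b_gt0 b_le5) sz => /orP[gw|ck].
  have [] := @simulation p q r pr_p pr_q pr_r odd_p odd_q odd_r pq pr qr w false
    (fun i => (i == 0)%N%:Z) gw _ n; last first.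
    by move=> n' ->; rewrite act_delta abs_coef_le_B.
  by split=> [[]|].
apply: le_trans (_ : (p * mu ^ k)%N%:Z <= _); last by rewrite lez_nat.
apply: (check_sound pr_p pr_q p_gt2 (p1_lt _ odd_q pq) (cop q pr_q pq) s_gt0 sp qs p_mu s_mu
  ps_mu mu_p ck).
by split=> [[]|].
Qed.

Theorem theorem1p8 (p q r b : nat) :
  prime p -> prime q -> prime r -> odd p -> odd q -> odd r ->
  (p < q)%N -> (q < r)%N ->
  (q%:Z = r%:Z %[mod p%:Z])%Z \/ (q%:Z = (- r%:Z)%R %[mod p%:Z])%Z ->
  (0 < b)%N -> (b <= 5)%N ->
  B (p * q ^ b)%N = B (p * r ^ b)%N.
Proof.
move=> pr_p pr_q pr_r odd_p odd_q odd_r pq q_lt_r qr b_gt0 b_le5.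
have pr : (p < r)%N := ltn_trans pq q_lt_r.
have qr' : q = r %[mod p] \/ (p %| q + r)%N.
  case: qr => [/eqP|/eqP].
    by rewrite !modz_nat => /eqP[]; left.
  by rewrite eqz_mod_dvd opprK; right.
have rq' : r = q %[mod p] \/ (p %| r + q)%N.
  by case: qr' => [->|]; [left | rewrite addnC; right].
by apply/eqP; rewrite eqn_leq !B_le_of_eqmod.
Qed.
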